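(* Let $X$ be the Markov mixture process on $\mathbb{S}=E\cup\{\Delta\}$, let $\Gamma_1,\Gamma_2$ be stochastically closed subsets of $\mathbb{S}$ with $\Gamma_1\cap\Gamma_2=\{\Delta\}$, $\tau_l=\inf\{t\ge0:X_t\in\Gamma_l\}$, and $\overline F_{i,t}(t_1,t_2)=\mathbb{P}\{\tau_1>t_1,\tau_2>t_2\mid\mathcal{F}_{t,i}\}$ for $i\in E$, $t_1,t_2\ge t\ge0$. The joint probability density $f_{i,t}(t_1,t_2)$ of $(\tau_1,\tau_2)$, i.e. of the measure $d\overline F_{i,t}$, is $$f_{i,t}(t_1,t_2)=\begin{cases}f^{(1)}_{i,t}(t_1,t_2),&t_1>t_2>t,\\ f^{(2)}_{i,t}(t_1,t_2),&t_2>t_1>t,\\ f^{(0)}_{i,t}(t_1,t_1),&t_1=t_2>t,\\ 1-\mathbf{e}_i^{\top}\mathbf{H}_2\mathbf{H}_1\mathbb{1},&t_1=t_2=t,\end{cases}$$ where $f^{(1)}_{i,t},f^{(2)}_{i,t}$ are densities with respect to $dt_1dt_2$ (absolutely continuous part), $f^{(0)}_{i,t}(t_1,t_1)$ is a density with respect to $dt_1$ on the diagonal $\{t_1=t_2>t\}$ (singular part), and the last line is a point mass at $(t,t)$; here $$f^{(1)}_{i,t}(t_1,t_2)=\sum_{k=1}^m\mathbf{e}_i^{\top}\mathbf{S}^{(k)}(t)e^{\mathbf{B}^{(k)}(t_2-t)}\big[\mathbf{B}^{(k)},\mathbf{H}_2\big]e^{\mathbf{B}^{(k)}(t_1-t_2)}\mathbf{B}^{(k)}\mathbf{H}_1\mathbb{1},$$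 $$f^{(2)}_{i,t}(t_1,t_2)=\sum_{k=1}^m\mathbf{e}_i^{\top}\mathbf{S}^{(k)}(t)e^{\mathbf{B}^{(k)}(t_1-t)}\big[\mathbf{B}^{(k)},\mathbf{H}_1\big]e^{\mathbf{B}^{(k)}(t_2-t_1)}\mathbf{B}^{(k)}\mathbf{H}_2\mathbb{1},$$ $$f^{(0)}_{i,t}(t_1,t_1)=\sum_{k=1}^m\mathbf{e}_i^{\top}\mathbf{S}^{(k)}(t)e^{\mathbf{B}^{(k)}(t_1-t)}\Big(\big[\mathbf{B}^{(k)},\mathbf{H}_2\big]\mathbf{H}_1+\big[\mathbf{B}^{(k)},\mathbf{H}_1\big]\mathbf{H}_2-\mathbf{B}^{(k)}\mathbf{H}_2\mathbf{H}_1\Big)\mathbb{1},$$ with $[A,B]=AB-BA$ the commutator.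
   Context: Mixture process: $E=\{1,\dots,n\}$ are the transient states, $\Delta=n+1$ is the absorbing state, $\mathbb{S}=E\cup\{\Delta\}$. For $k=1,\dots,m$, $\mathbf{Q}^{(k)}=\begin{pmatrix}\mathbf{B}^{(k)}&-\mathbf{B}^{(k)}\mathbb{1}\\ \mathbf{0}&0\end{pmatrix}$ is an intensity matrix on $\mathbb{S}$ (nonnegative off-diagonal entries, zero row sums) with $\mathbf{B}^{(k)}$ an $n\times n$ nonsingular matrix. On a probability space there are an unobserved regime $\phi\in\{1,\dots,m\}$ and an $\mathbb{S}$-valued right-continuous process $X=(X_t)_{t\ge0}$ such that $\mathbb{P}\{X_0=i\}=\pi_i$ for $i\in E$, $\mathbb{P}\{X_0=\Delta\}=0$, $\mathbb{P}\{\phi=k\mid X_0=i\}=s_i^{(k)}$ with $\sum_k s_i^{(k)}=1$, and, given $\phi=k$ and $X_0=i$, $X$ is a time-homogeneous Markov jump process with intensity matrix $\mathbf{Q}^{(k)}$ started at $i$. Closed sets: $\Gamma_l$ stochastically closed means $[\mathbf{Q}^{(k)}]_{i,j}=0$ for all $k$ whenever $i\in\Gamma_l$, $j\in\Gamma_l^c$. It is assumed that $\pi_i\ne0$ for $i\in\Gamma_1^c\cap\Gamma_2^c$ and $\mathbb{P}\{\tau_1>0,\tau_2>0\}=1$. $\mathbf{H}_l$ is the $n\times n$ diagonal matrix with $[\mathbf{H}_l]_{ii}=1$ if $i\in\Gamma_l^c$ and $0$ otherwise, $i\in E$. Information: $\mathcal{F}_{t-}$ is any sub-$\sigma$-field of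 $\sigma(X_s:0\le s<t)$ (full, partial, or no information). $\mathcal{F}_{t,i}$ denotes $\mathcal{F}_{t-}$ together with $X_t=i$: $\mathbb{P}\{A\mid\mathcal{F}_{t,i}\}:=\mathbb{P}\{A\cap\{X_t=i\}\mid\mathcal{F}_{t-}\}/\mathbb{P}\{X_t=i\mid\mathcal{F}_{t-}\}$ where the denominator is positive; identities are almost sure there. $\mathbf{S}^{(k)}(t)=\mathrm{diag}(s_1^{(k)}(t),\dots,s_n^{(k)}(t))$ with $s_i^{(k)}(t)=\mathbb{P}\{\phi=k\mid\mathcal{F}_{t,i}\}$ (completed arbitrarily to nonnegative weights summing to $1$ over $k$ where undefined). $\mathbf{e}_i$ is the $i$th unit vector, $\mathbb{1}$ the all-ones vector. The measure $d\overline F_{i,t}$: the probability measure on $\{(t,t)\}\cup(t,\infty)^2$ giving mass $\overline F_{i,t}(t_1,t_2)$ to $(t_1,\infty)\times(t_2,\infty)$ for all $t_1,t_2\ge t$; thus the residual mass $1-\overline F_{i,t}(t,t)$ is placed at the point $(t,t)$. For $i\in\Gamma_1^c\cap\Gamma_2^c$ it is the conditional law of $(\tau_1,\tau_2)$ given $\mathcal{F}_{t,i}$. *)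

(* Defs.v *)
From HB Require Import structures.
From mathcomp Require Import all_boot all_order all_algebra.
From mathcomp Require Import all_classical all_reals all_analysis.

Set Implicit Arguments.
Unset Strict Implicit.
Unset Printing Implicit Defensive.

Import Order.TTheory GRing.Theory Num.Theory.
Import numFieldNormedType.Exports.

Local Open Scope classical_set_scope.
Local Open Scope ring_scope.

Definition expmx (R : realType) (n : nat) (A : 'M[R]_n) : 'M[R]_n :=
  \matrix_(i, j) limn (series (fun k => (k`!%:R)^-1 * (A ^+ k) i j)).

Definition commutator (R : realType) (n : nat) (A B : 'M[R]_n) : 'M[R]_n :=
  A *m B - B *m A.

Definition is_intensity (R : realType) (n : nat) (Q : 'M[R]_n) : Prop :=
  (forall i j, i != j -> 0 <= Q i j) /\ (forall i, \sum_j Q i j = 0).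

(* The state space is 'I_(n + 1): the transient states E are the [transient i]
   with i : 'I_n, and [absorbing] is the state Delta. *)
Definition transient (n : nat) (i : 'I_n) : 'I_(n + 1) := lshift 1 i.
Definition absorbing (n : nat) : 'I_(n + 1) := rshift n ord0.

Definition intensity_of (R : realType) (n : nat) (B : 'M[R]_n) :
    'M[R]_(n + 1) :=
  block_mx B (- (B *m const_mx 1)) 0 0.

Definition stochastically_closed (R : realType) (m n : nat)
    (Q : 'I_m -> 'M[R]_n) (Gam : {set 'I_n}) : Prop :=
  forall k i j, i \in Gam -> j \notin Gam -> Q k i j = 0.

(* The matrix H_l attached to the set Gamma_l. *)
Definition outside_mx (R : realType) (n : nat) (Gam : {set 'I_(n + 1)}) :
    'M[R]_n :=
  diag_mx (\row_i (transient i \notin Gam)%:R).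

Section conditioning.
Context {d : measure_display} {T : measurableType d} {R : realType}.
Variable P : probability T R.

(* Elementary conditional probability; meaningful only if P C != 0. *)
Definition cprob (A C : set T) : R := fine (P (A `&` C)) / fine (P C).

(* Y is a version of P{A | G}, for a sub-sigma-field G. *)
Definition is_condprob (G : set (set T)) (A : set T) (Y : T -> R) : Prop :=
  [/\ forall U : set R, measurable U -> G (Y @^-1` U),
      P.-integrable setT (EFin \o Y) &
      forall C, G C -> (\int[P]_(w in C) (Y w)%:E = P (A `&` C))%E].

(* Y is a version of P{A | G, D} = P{A /\ D | G} / P{D | G}; no constraint is
   put on Y where P{D | G} vanishes. *)
Definition is_condprob_on (G : set (set T)) (D A : set T) (Y : T -> R) : Prop :=
  exists p q : T -> R,
    [/\ is_condprob G D p, is_condprob G (A `&` D) q &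
        {ae P, forall w, 0 < p w -> Y w = q w / p w}].

End conditioning.

Section processes.
Context {d : measure_display} {T : measurableType d} {R : realType} {N : nat}.
Implicit Types (X : R -> T -> 'I_N).

Definition history X (h : seq (R * 'I_N)) : set T :=
  [set w | forall e, e \in h -> X e.1 w = e.2].

(* Under P( . | C), X is a time-homogeneous Markov jump process with intensity
   matrix Q started at i. *)
Definition markov_jump (P : probability T R) (C : set T) X (Q : 'M[R]_N)
    (i : 'I_N) : Prop :=
  cprob P [set w | X 0 w = i] C = 1 /\
  forall (h : seq (R * 'I_N)) (t u : R) (x y : 'I_N),
    (forall e, e \in h -> 0 <= e.1 <= t) -> 0 <= t -> 0 <= u ->
    P (C `&` (history X h `&` [set w | X t w = x])) != 0%E ->
    cprob P [set w | X (t + u) w = y]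
      (C `&` (history X h `&` [set w | X t w = x])) = expmx (u *: Q) x y.

(* Right-continuity for the discrete topology on the state space. *)
Definition path_right_continuous X : Prop :=
  forall w t, 0 <= t -> \forall s \near t^'+, X s w = X t w.

(* sigma(X_s : 0 <= s < t) *)
Definition strict_past X (t : R) : set (set T) :=
  <<s [set A | exists s x, 0 <= s < t /\ A = [set w | X s w = x]] >>.

Definition hitting_time X (Gam : {set 'I_N}) (w : T) : \bar R :=
  ereal_inf [set s%:E | s in [set s : R | 0 <= s /\ X s w \in Gam]].

End processes.

Record is_mixture_process (d : measure_display) (T : measurableType d)
    (R : realType) (P : probability T R) (m n : nat)
    (B : 'I_m -> 'M[R]_n) (pi0 : 'I_n -> R) (s0 : 'I_m -> 'I_n -> R)
    (phi : T -> 'I_m) (X : R -> T -> 'I_(n + 1)) : Prop := {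
  mix_intensity : forall k, is_intensity (intensity_of (B k)) ;
  mix_nonsingular : forall k, B k \in unitmx ;
  mix_phi_measurable : forall k, measurable [set w | phi w = k] ;
  mix_X_measurable : forall t x, 0 <= t -> measurable [set w | X t w = x] ;
  mix_right_continuous : path_right_continuous X ;
  mix_init : forall i, P [set w | X 0 w = transient i] = (pi0 i)%:E ;
  mix_init_absorbing : P [set w | X 0 w = absorbing n] = 0%E ;
  mix_regime_sum : forall i, \sum_k s0 k i = 1 ;
  mix_regime : forall k i, P [set w | X 0 w = transient i] != 0%E ->
    cprob P [set w | phi w = k] [set w | X 0 w = transient i] = s0 k i ;
  mix_markov : forall k i,
    P ([set w | phi w = k] `&` [set w | X 0 w = transient i]) != 0%E ->
    markov_jump P ([set w | phi w = k] `&` [set w | X 0 w = transient i])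
      X (intensity_of (B k)) (transient i)
}.

Section joint_law.
Context {R : realType}.
Implicit Types mu : probability (measurableTypeR R * measurableTypeR R)%type R.

(* mu is the measure dF attached to the survival function F at time t; that the
   mass 1 - F t t sits at (t, t) follows from the two clauses. *)
Definition is_survival_measure (t : R) (F : R -> R -> R) mu : Prop :=
  mu (~` ([set (t, t)] `|` [set z | t < z.1 /\ t < z.2])) = 0%E /\
  forall t1 t2, t <= t1 -> t <= t2 ->
    mu [set z | t1 < z.1 /\ t2 < z.2] = (F t1 t2)%:E.

(* mu has density f with respect to the sum of the Lebesgue measure on the
   off-diagonal part of (t, oo)^2, the measure dt_1 on the half-diagonal
   {t_1 = t_2 > t}, and the unit mass at (t, t). *)
Definition has_joint_density (t : R) (f : R -> R -> R) mu : Prop :=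
  [/\ measurable_fun setT
        (fun z : measurableTypeR R * measurableTypeR R => f z.1 z.2),
      forall t1 t2, (t < t1 /\ t < t2) \/ (t1 = t /\ t2 = t) -> 0 <= f t1 t2 &
      forall A, measurable A -> mu A =
        (\int[(@lebesgue_measure R \x @lebesgue_measure R)%E]_(z in
             A `&` [set z : R * R | [/\ t < z.1, t < z.2 & z.1 != z.2]%R])
           (f z.1 z.2)%:E
         + \int[@lebesgue_measure R]_(x in [set x : R | (t < x)%R /\ A (x, x)])
             (f x x)%:E
         + (f t t)%:E * \d_((t, t)) A)%E].

End joint_law.

Section density.
Context {R : realType} {m n : nat}.
Variables (B : 'I_m -> 'M[R]_n) (H1 H2 : 'M[R]_n) (S : 'I_m -> 'M[R]_n).
Variables (i : 'I_n) (t : R).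

Let e : 'rV[R]_n := delta_mx ord0 i.
Let one : 'cV[R]_n := const_mx 1.

Definition density1 (t1 t2 : R) : R :=
  \sum_k (e *m S k *m expmx ((t2 - t) *: B k) *m commutator (B k) H2
    *m expmx ((t1 - t2) *: B k) *m B k *m H1 *m one) ord0 ord0.

Definition density2 (t1 t2 : R) : R :=
  \sum_k (e *m S k *m expmx ((t1 - t) *: B k) *m commutator (B k) H1
    *m expmx ((t2 - t1) *: B k) *m B k *m H2 *m one) ord0 ord0.

Definition density0 (t1 : R) : R :=
  \sum_k (e *m S k *m expmx ((t1 - t) *: B k) *m
    (commutator (B k) H2 *m H1 + commutator (B k) H1 *m H2 - B k *m H2 *m H1)
    *m one) ord0 ord0.

Definition atom_mass : R := 1 - (e *m H2 *m H1 *m one) ord0 ord0.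

Definition joint_density (t1 t2 : R) : R :=
  if t < t2 < t1 then density1 t1 t2
  else if t < t1 < t2 then density2 t1 t2
  else if (t1 == t2) && (t < t1) then density0 t1
  else if (t1 == t) && (t2 == t) then atom_mass
  else 0.

End density.

(* Main.v *)
(* The law is determined by its masses on the quadrants (t1, oo) x (t2, oo) with
   t1, t2 in a countable dense set, so it suffices to identify these masses and to
   integrate the candidate density over quadrants.

   Masses: closed sets are a.s. never left, so by right continuity tau_l > u is
   a.s. the event that X_u lies outside Gamma_l.  The Markov property, extended
   from finite histories to the past of t by a pi-lambda argument, gives for
   t2 <= t1, with B = B^(k),
     e_i S e^{(t2-t)B} H2 e^{(t1-t2)B} H1 1   (summed over k).

   Density: closedness reads B H = H B H, whence [B,H] = - H B (1-H) <= 0, and the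
   densities are nonnegative.  Since B is a nonsingular subintensity matrix,
   e^{uB} -> 0, so that the integral over t1 is an exact difference.  The product
   e^{(y-t)B} H2 e^{(t1-y)B} has derivative e^{(y-t)B} [B,H2] e^{(t1-y)B}, which
   gives the integral over t2 up to t1.  Beyond t1 the two triangular parts and
   the diagonal part combine into the integral of - e^{(y-t)B} B H2 H1 1. *)

Require Import Defs.
From HB Require Import structures.
From mathcomp Require Import all_boot all_order all_algebra.
From mathcomp Require Import all_classical all_reals all_analysis.
From mathcomp Require Import measurable_realfun ring lra.

Set Implicit Arguments.
Unset Strict Implicit.
Unset Printing Implicit Defensive.

Import Order.TTheory GRing.Theory Num.Theory.
Import numFieldNormedType.Exports.

Local Open Scope classical_set_scope.
Local Open Scope ring_scope.

(** * Matrix exponential *)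

(** Conditioning enters only through the weights s_i^(k)(t). For a fixed outcome with nonnegative
    weights of sum 1 the problem is deterministic: a probability with the stated density is
    assembled from its three pieces and its survival function is computed. The probabilistic half
    identifies that function with conditional probabilities. What makes joining the halves delicate
    is that a version of the conditional survival probability is fixed only up to a null set
    depending on (t_1, t_2), while the density claim concerns one law per outcome; hence the
    countable set of quadrants.

    The sign of the densities is a working tool: it gives Tonelli's theorem and the fundamental
    theorem on unbounded intervals without integrability estimates. Only one triangle is computed,
    since f^(2) is f^(1) with the sets and the times exchanged. On the diagonal both sets are
    entered at once, which can only be a jump to Delta, their single common state; this is the
    meaning of the identity that turns the matrix of f^(0) into - H_1 H_2 B^(k). *)

Section matrix_exponential.
Context {R : realType} {n : nat}.
Implicit Types A : 'M[R]_n.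

Lemma mxpow_bound A :
  exists2 C : R, 0 <= C & forall k i j, `|(A ^+ k) i j| <= C ^+ k.
Proof.
(* The sum over all entries dominates every row sum, so one more factor [A] costs at most one more
   factor of this constant. *)
exists (\sum_i \sum_j `|A i j|); first by do 2!apply: sumr_ge0 => ? _.
elim=> [|k IHk] i j.
  by rewrite !expr0 mxE; case: (i == j); rewrite ?normr1 ?normr0.
rewrite !exprS mxE; apply: le_trans (ler_norm_sum _ _ _) _.
set C := \sum_i _ in IHk *.
apply: (@le_trans _ _ (\sum_l `|A i l| * C ^+ k)).
  by apply: ler_sum => l _; rewrite normrM ler_wpM2l// IHk.
rewrite -mulr_suml ler_wpM2r//.
  by rewrite exprn_ge0//; do 2!apply: sumr_ge0 => ? _.
rewrite /C [leRHS](bigD1 i)//= lerDl.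
by apply: sumr_ge0 => l _; apply: sumr_ge0 => ? _.
Qed.

Lemma mxpowZ A (x : R) k : (x *: A) ^+ k = x ^+ k *: A ^+ k.
Proof.
elim: k => [|k IHk]; first by rewrite !expr0 scale1r.
rewrite !exprS IHk; apply/matrixP => i j; rewrite !mxE mulr_sumr.
by apply: eq_bigr => l _; rewrite !mxE; ring.
Qed.

(** Power series coefficients of an entry of A^p e^(xA). The shift [p] makes the family stable under
    termwise differentiation, which raises [p] by one. *)
Definition expcoef A i j p : R^nat := fun k => (k`!%:R)^-1 * (A ^+ (k + p)) i j.

Lemma expcoef_cvg A i j p x : cvgn (pseries (expcoef A i j p) x).
Proof.
have [C C0 HC] := mxpow_bound A.
apply: normed_cvg.
apply: (@series_le_cvg _ _ (fun k => C ^+ p * exp_coeff (C * `|x|) k)).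
- by move=> k /=.
- move=> k /=; rewrite mulr_ge0 ?exprn_ge0// divr_ge0// exprn_ge0//.
  by rewrite mulr_ge0.
- move=> k; rewrite /expcoef /exp_coeff /= !normrM normfV normrX.
  rewrite (@ger0_norm _ k`!%:R)// exprMn.
  rewrite [leRHS](_ : _ = k`!%:R^-1 * (C ^+ (k + p)) * `|x| ^+ k); last first.
    by rewrite exprD; ring.
  by rewrite ler_wpM2r ?exprn_ge0// ler_wpM2l ?invr_ge0.
rewrite (_ : series _ = (fun N => C ^+ p * series (exp_coeff (C * `|x|)) N)).
  by apply: is_cvgMr; exact: is_cvg_series_exp_coeff.
by apply/funext => N; rewrite /series /= mulr_sumr.
Qed.

Lemma expcoef_diffs A i j p :
  pseries_diffs (expcoef A i j p) = expcoef A i j p.+1.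
Proof.
apply/funext => k; rewrite /pseries_diffs /expcoef addnS addSn factS natrM.
by rewrite invfM !mulrA divff ?mul1r// pnatr_eq0.
Qed.

Lemma expmxE A x i j :
  expmx (x *: A) i j = limn (pseries (expcoef A i j 0) x).
Proof.
rewrite mxE; congr (limn _); apply/funext => N; apply: eq_bigr => k _.
by rewrite /= mxpowZ mxE /expcoef addn0; ring.
Qed.

(** The extra factor of A^(k+1) is split off on the left here and on the right in [expcoef_mulr];
    comparing the two shows that A commutes with its exponential. *)
Lemma expcoef_mull A i j x :
  limn (pseries (expcoef A i j 1) x) = (A *m expmx (x *: A)) i j.
Proof.
rewrite mxE; under eq_bigr do rewrite expmxE.
apply/cvg_lim => //.
rewrite (_ : pseries _ x = fun N => \sum_l A i l * pseries (expcoef A l j 0) x N).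
  apply: cvg_big => [|l _]; first exact: add_continuous.
  apply: cvgMr; exact: expcoef_cvg.
apply/funext => N.
under eq_bigr do rewrite /pseries /series /= mulr_sumr.
rewrite exchange_big; apply: eq_bigr => k _ /=.
rewrite /expcoef addn0 addn1 exprS mxE mulr_sumr mulr_suml.
by apply: eq_bigr => l _; ring.
Qed.

Lemma expcoef_mulr A i j x :
  limn (pseries (expcoef A i j 1) x) = (expmx (x *: A) *m A) i j.
Proof.
rewrite mxE; under eq_bigr do rewrite expmxE.
apply/cvg_lim => //.
rewrite (_ : pseries _ x = fun N => \sum_l pseries (expcoef A i l 0) x N * A l j).
  apply: cvg_big => [|l _]; first exact: add_continuous.
  apply: cvgMl; exact: expcoef_cvg.
apply/funext => N.
under eq_bigr do rewrite /pseries /series /= mulr_suml.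
rewrite exchange_big; apply: eq_bigr => k _ /=.
rewrite /expcoef addn0 addn1 exprSr mxE mulr_sumr mulr_suml.
by apply: eq_bigr => l _; ring.
Qed.

Lemma expmxC A x : A *m expmx (x *: A) = expmx (x *: A) *m A.
Proof. by apply/matrixP => i j; rewrite -expcoef_mull expcoef_mulr. Qed.

Lemma expmx0 A : expmx (0 *: A) = 1%:M.
Proof.
apply/matrixP => i j; rewrite expmxE; apply/cvg_lim => //.
apply: cvg_near_cst; exists 1%N => // -[//|N] _.
rewrite /pseries /series /= big_nat_recl//= big1 => [|k _].
  by rewrite /expcoef addr0 fact0 invr1 mul1r addn0 !expr0 mulr1.
by rewrite expr0n mulr0.
Qed.

End matrix_exponential.

(* Entrywise derivatives, since the library has no product rule for [mulmx]. *)
Definition mx_derive {R : realType} {p q : nat} (M : R -> 'M[R]_(p, q))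
    (x : R) (M' : 'M[R]_(p, q)) : Prop :=
  forall i j, is_derive x (1 : R) (fun u => M u i j) (M' i j).

(** * Differentiation of the matrix exponential *)

Section matrix_derivative.
Context {R : realType}.
Implicit Types x : R.

Lemma mx_derive_cst p q (M : 'M[R]_(p, q)) x : mx_derive (fun=> M) x 0.
Proof. by move=> i j; rewrite mxE; exact: is_derive_cst. Qed.

Lemma mx_derive_eq p q (M : R -> 'M[R]_(p, q)) x M' M'' :
  mx_derive M x M' -> M' = M'' -> mx_derive M x M''.
Proof. by move=> ? <-. Qed.

Lemma mx_derive_mul p q r (M : R -> 'M[R]_(p, q)) (N : R -> 'M[R]_(q, r)) x M' N' :
  mx_derive M x M' -> mx_derive N x N' ->
  mx_derive (fun u => M u *m N u) x (M' *m N x + M x *m N').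
Proof.
move=> HM HN i j.
rewrite (_ : (fun u => _) = \sum_l (fun u => M u i l * N u l j)); last first.
  by apply/funext => u; rewrite mxE fct_sumE.
rewrite !mxE -big_split/=; apply: is_derive_sum => l.
apply: is_derive_eq; first exact: (is_deriveM (HM i l) (HN l j)).
by rewrite addrC; congr (_ + _); exact: mulrC.
Qed.

Lemma mx_derive_comp p q (M : R -> 'M[R]_(p, q)) (f : R -> R) x M' f' :
  mx_derive M (f x) M' -> is_derive x (1 : R) f f' ->
  mx_derive (fun u => M (f u)) x (f' *: M').
Proof.
move=> HM Hf i j; rewrite mxE mulrC.
exact: (@is_derive1_comp _ (fun u => M u i j) f _ _ _ (HM i j) Hf).
Qed.

Lemma mx_derive_sum p q m (M : 'I_m -> R -> 'M[R]_(p, q)) x M' :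
  (forall k, mx_derive (M k) x (M' k)) ->
  mx_derive (fun u => \sum_k M k u) x (\sum_k M' k).
Proof.
move=> HM i j.
rewrite (_ : (fun u => _) = \sum_k (fun u => M k u i j)); last first.
  by apply/funext => u; rewrite summxE fct_sumE.
by rewrite summxE; apply: is_derive_sum => k; exact: HM.
Qed.

Lemma mx_derive_exp n (A : 'M[R]_n) x :
  mx_derive (fun u => expmx (u *: A)) x (A *m expmx (x *: A)).
Proof.
move=> i j; rewrite -expcoef_mull.
rewrite (_ : (fun u => _) = fun u => limn (pseries (expcoef A i j 0) u)); last first.
  by apply/funext => u; rewrite expmxE.
rewrite -expcoef_diffs.
(* The series converge everywhere, so any radius beyond |x| will do. *)
apply: (@pseries_snd_diffs _ _ (`|x| + 1)); rewrite ?expcoef_diffs.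
- exact: expcoef_cvg.
- exact: expcoef_cvg.
- exact: expcoef_cvg.
- by rewrite [ltRHS]ger0_norm// addrC -subr_gt0 addrK.
Qed.

Lemma mx_derive0_cst p q (M : R -> 'M[R]_(p, q)) :
  (forall x, mx_derive M x 0) -> forall x y, M x = M y.
Proof.
move=> HM x y; apply/matrixP => i j.
have H z : is_derive z (1 : R) (fun u => M u i j) 0.
  by have := HM z i j; rewrite mxE.
by have := is_derive_0_is_cst x y H.
Qed.

(** The product has derivative zero and so keeps its value at 0; this avoids a Cauchy product of the
    two series. *)
Lemma expmxNl n (A : 'M[R]_n) x : expmx (- x *: A) *m expmx (x *: A) = 1%:M.
Proof.
have H u : mx_derive (fun u => expmx (- u *: A) *m expmx (u *: A)) u 0.
  apply: mx_derive_eq; first apply: mx_derive_mul.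
  - apply: (@mx_derive_comp _ _ (fun u => expmx (u *: A)) -%R _ _ (-1)).
    exact: mx_derive_exp.
  - exact: mx_derive_exp.
  by rewrite scaleN1r mulNmx expmxC -mulmxA addrC subrr.
by rewrite (mx_derive0_cst H x 0) oppr0 expmx0 mulmx1.
Qed.

(* Variation of constants: e^{-xA} M is constant. *)
Lemma expmx_unique n (A : 'M[R]_n) (M : R -> 'M[R]_n) :
  M 0 = 1%:M -> (forall x, mx_derive M x (A *m M x)) ->
  forall x, M x = expmx (x *: A).
Proof.
move=> M0 HM x.
have H u : mx_derive (fun u => expmx (- u *: A) *m M u) u 0.
  apply: mx_derive_eq; first apply: mx_derive_mul.
  - apply: (@mx_derive_comp _ _ (fun u => expmx (u *: A)) -%R _ _ (-1)).
    exact: mx_derive_exp.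
  - exact: HM.
  by rewrite scaleN1r mulNmx expmxC -mulmxA addrC subrr.
have := mx_derive0_cst H x 0; rewrite oppr0 expmx0 M0 mulmx1 => H1.
have := expmxNl A (- x); rewrite opprK => H2.
by rewrite -[LHS]mul1mx -H2 -mulmxA H1 mulmx1.
Qed.

End matrix_derivative.

(** * Positivity and decay of the exponential of a subintensity matrix *)

Section subintensity.
Context {R : realType}.

Definition mx_ge0 p q (M : 'M[R]_(p, q)) : Prop := forall i j, 0 <= M i j.

Lemma mx_ge0M p q r (M : 'M[R]_(p, q)) (N : 'M[R]_(q, r)) :
  mx_ge0 M -> mx_ge0 N -> mx_ge0 (M *m N).
Proof. by move=> M0 N0 i j; rewrite mxE; apply: sumr_ge0 => l _; exact: mulr_ge0. Qed.

Lemma mx_ge0D p q (M N : 'M[R]_(p, q)) :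
  mx_ge0 M -> mx_ge0 N -> mx_ge0 (M + N).
Proof. by move=> M0 N0 i j; rewrite mxE addr_ge0. Qed.

Lemma mx_ge0_const p q (a : R) : 0 <= a -> mx_ge0 (const_mx a : 'M[R]_(p, q)).
Proof. by move=> a0 i j; rewrite mxE. Qed.

(* The generator of a jump process killed at an a.s. finite time. *)
Record is_subintensity n (B : 'M[R]_n) : Prop := {
  sub_off : forall i j, i != j -> 0 <= B i j ;
  sub_row : mx_ge0 (- (B *m (const_mx 1 : 'cV_n))) ;
  sub_unit : B \in unitmx }.

Lemma expmx_nonneg_ge0 n (A : 'M[R]_n) x : mx_ge0 A -> 0 <= x ->
  mx_ge0 (expmx (x *: A)).
Proof.
move=> A0 x0 i j; rewrite expmxE; apply: limr_ge.
  exact: expcoef_cvg.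
near=> N; apply: sumr_ge0 => k _; rewrite mulr_ge0 ?exprn_ge0//.
rewrite /expcoef mulr_ge0 ?invr_ge0// addn0.
elim: k i j => [|k IHk] i j; first by rewrite expr0 mxE; case: (i == j).
by rewrite exprS; apply: mx_ge0M.
Unshelve. all: by end_near. Qed.

Lemma expmx_shift n (A : 'M[R]_n) (c x : R) :
  expR (- c * x) *: expmx (x *: (A + c%:M)) = expmx (x *: A).
Proof.
move: x; apply: expmx_unique => [|x i j].
  by rewrite mulr0 expR0 scale1r expmx0.
have He : is_derive x (1 : R) (fun u => expR (- c * u)) (- c * expR (- c * x)).
  have Hl : is_derive x (1 : R) (fun u => - c * u) (- c).
    by have := is_deriveZ (- c) (is_derive_id x (1 : R)); rewrite /GRing.scale/= mulr1.
  by rewrite mulrC; exact: (@is_derive1_comp _ expR (fun u => - c * u) x _ _ _ Hl).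
rewrite (_ : (fun u => _) = (fun u => expR (- c * u)) *
  (fun u => expmx (u *: (A + c%:M)) i j)); last first.
  by apply/funext => u; rewrite mxE.
apply: is_derive_eq.
  exact: (is_deriveM He (mx_derive_exp (A + c%:M) x i j)).
rewrite mulmxDl mul_scalar_mx -scalemxAr !mxE /GRing.scale/=; ring.
Qed.

(** Uniformization: B + c I is entrywise nonnegative once c dominates the diagonal of -B, its
    exponential series then has nonnegative terms, and undoing the shift only multiplies by
    e^(-cx). *)
Lemma expmx_ge0 n (B : 'M[R]_n) x : (forall i j, i != j -> 0 <= B i j) ->
  0 <= x -> mx_ge0 (expmx (x *: B)).
Proof.
move=> B0 x0; pose c := \sum_l `|B l l|.
rewrite -(expmx_shift B c) => i j; rewrite mxE mulr_ge0 ?expR_ge0//.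
apply: expmx_nonneg_ge0 => // k l; rewrite !mxE.
have [<-|kl] := eqVneq k l; last by rewrite mulr0n addr0 B0.
rewrite mulr1n /c (bigD1 k)//= addrA addr_ge0//; last exact: sumr_ge0.
by rewrite -lerBlDl sub0r -normrN ler_norm.
Qed.

Lemma le_derive_le (f : R -> R) (f' : R -> R) :
  (forall x, is_derive x (1 : R) f (f' x)) -> (forall x, 0 <= x -> f' x <= 0) ->
  forall x y, 0 <= x -> x <= y -> f y <= f x.
Proof.
move=> Hf f'0 x y x0 xy.
have [|c] := @MVT_segment R f f' x y xy (fun z _ => Hf z).
  apply/continuous_subspaceT=> r.
  exact/differentiable_continuous/derivable1_diffP.
rewrite in_itv/= => /andP[xc cy] E; rewrite -subr_le0 E.
by rewrite mulr_le0_ge0 ?subr_ge0// f'0// (le_trans x0).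
Qed.

Variables (n : nat) (B : 'M[R]_n).
Hypothesis HB : is_subintensity B.

Let one : 'cV[R]_n := const_mx 1.
Let rowsum i u := (expmx (u *: B) *m one) i 0.

Let rowsum_derive i u : is_derive u (1 : R) (rowsum i) ((expmx (u *: B) *m (B *m one)) i 0).
Proof.
have H : mx_derive (fun u => expmx (u *: B) *m one) u (expmx (u *: B) *m (B *m one)).
  apply: mx_derive_eq.
    by apply: mx_derive_mul; [exact: mx_derive_exp|exact: mx_derive_cst].
  by rewrite mulmx0 addr0 expmxC mulmxA.
exact: H.
Qed.

Let rowsum_le i u v : 0 <= u -> u <= v -> rowsum i v <= rowsum i u.
Proof.
apply: (le_derive_le (rowsum_derive i)) => x x0.
suff: 0 <= (expmx (x *: B) *m - (B *m one)) i 0 by rewrite mulmxN mxE oppr_ge0.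
by apply: mx_ge0M; [exact: expmx_ge0 (sub_off HB) x0|exact: sub_row].
Qed.

Let expmx_le_rowsum i j u : 0 <= u -> expmx (u *: B) i j <= rowsum i u.
Proof.
move=> u0; rewrite /rowsum [leRHS]mxE (bigD1 j)//= [one _ _]mxE mulr1 lerDl.
apply: sumr_ge0 => l _; rewrite [one _ _]mxE mulr1.
exact: expmx_ge0 (sub_off HB) u0 _ _.
Qed.

(* The row sums w(u) of e^{uB} decrease and B^{-1} e^{uB} 1 is a bounded
   primitive of them, so that u w(u) stays bounded. *)
Let rowsum_bound i : exists C : R, forall u, 0 < u -> u * rowsum i u <= C.
Proof.
pose b := invmx B *m one; pose g u := (expmx (u *: B) *m b) i 0.
pose K := \sum_l `|b l 0|.
have gK u : 0 <= u -> `|g u| <= K.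
  move=> u0; rewrite /g mxE; apply: le_trans (ler_norm_sum _ _ _) _.
  apply: ler_sum => l _; rewrite normrM -[leRHS]mul1r ler_wpM2r//.
  rewrite ger0_norm; last exact: expmx_ge0 (sub_off HB) u0 _ _.
  apply: le_trans (expmx_le_rowsum _ _ u0) _.
  apply: le_trans (rowsum_le i (lexx 0) u0) _.
  by rewrite /rowsum expmx0 mul1mx mxE.
exists (K + K) => u u0.
have Hg x : is_derive x (1 : R) g (rowsum i x).
  have H : mx_derive (fun u => expmx (u *: B) *m b) x (expmx (x *: B) *m one).
    apply: mx_derive_eq.
      by apply: mx_derive_mul; [exact: mx_derive_exp|exact: mx_derive_cst].
    by rewrite mulmx0 addr0 expmxC -mulmxA mulKVmx// sub_unit.
  exact: H.
have [|c] := @MVT_segment R g (rowsum i) 0 u (ltW u0) (fun z _ => Hg z).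
  apply/continuous_subspaceT=> r.
  exact/differentiable_continuous/derivable1_diffP.
rewrite in_itv/= subr0 => /andP[c0 cu] E.
apply: (@le_trans _ _ (g u - g 0)).
  by rewrite E mulrC ler_wpM2r ?(ltW u0)// rowsum_le.
apply: le_trans (ler_norm _) _; apply: le_trans (ler_normB _ _) _.
by rewrite lerD ?gK// ltW.
Qed.

(** Each entry lies between 0 and its row sum, which is at most C/u. This crude rate replaces any
    spectral argument and is enough to kill the boundary terms at infinity. *)
Lemma expmx_cvg0 i j : expmx (u *: B) i j @[u --> +oo] --> 0.
Proof.
have [C HC] := rowsum_bound i.
apply: (@squeeze_cvgr _ _ _ _ (cst 0) (fun u => C * u^-1)).
- near=> u.
  have u0 : 0 < u by near: u; exact: nbhs_pinfty_gt.
  rewrite (expmx_ge0 (sub_off HB) (ltW u0))/=.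
  apply: le_trans (expmx_le_rowsum _ _ (ltW u0)) _.
  by rewrite ler_pdivlMr// mulrC HC.
- exact: cvg_cst.
- rewrite -[X in _ --> X](mulr0 C); apply: cvgMr.
  apply/gtr0_cvgV0; last exact: cvg_id.
  by near=> u; near: u; exact: nbhs_pinfty_gt.
Unshelve. all: by end_near. Qed.

End subintensity.

Lemma cvg_sum0 {R : realType} (I : finType) (f : I -> R -> R)
    (F : set_system R) : Filter F ->
  (forall i, f i x @[x --> F] --> 0) -> \sum_i f i x @[x --> F] --> 0.
Proof.
move=> FF f0.
rewrite [X in _ --> X](_ : 0 = \sum_(i : I) (0 : R)); last by rewrite big1.
by apply: cvg_big => [|i _]; [exact: add_continuous|exact: f0].
Qed.

(** * Scalar exponential sums over the regimes and their integrals *)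

Section exponential_sums.
Context {R : realType} {m n : nat}.
Variable B : 'I_m -> 'M[R]_n.
Implicit Types (v : 'I_m -> 'rV[R]_n) (w : 'I_m -> 'cV[R]_n).

(** The shape shared by the densities as functions of one time. Differentiation and integration in
    [u] act on the column [w] alone, through B^(k) and its inverse. *)
Definition expsum v w (u : R) : R :=
  (\sum_k v k *m expmx (u *: B k) *m w k) 0 0.

Lemma expsumD v w w' u :
  expsum v (fun k => w k + w' k) u = expsum v w u + expsum v w' u.
Proof.
rewrite /expsum; under eq_bigr do rewrite mulmxDr.
by rewrite big_split mxE.
Qed.

Lemma expsumN v w u : expsum v (fun k => - w k) u = - expsum v w u.
Proof.
by rewrite /expsum; under eq_bigr do rewrite mulmxN; rewrite sumrN mxE.
Qed.

Lemma is_derive_expsum v w u :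
  is_derive u (1 : R) (expsum v w) (expsum v (fun k => B k *m w k) u).
Proof.
suff H : mx_derive (fun u => \sum_k v k *m expmx (u *: B k) *m w k) u
    (\sum_k v k *m expmx (u *: B k) *m (B k *m w k)) by exact: H.
apply: mx_derive_sum => k; apply: mx_derive_eq.
  apply: mx_derive_mul; last exact: mx_derive_cst.
  apply: mx_derive_mul; first exact: mx_derive_cst.
  exact: mx_derive_exp.
by rewrite mulmx0 addr0 mul0mx add0r expmxC !mulmxA.
Qed.

Lemma is_derive_continuous (f : R -> R) (f' : R -> R) :
  (forall x, is_derive x (1 : R) f (f' x)) -> continuous f.
Proof.
move=> Hf x; apply/differentiable_continuous/derivable1_diffP.
by have := Hf x => -[].
Qed.

Lemma is_derive_expsum_shift v w (y x : R) :
  is_derive x (1 : R) (fun x => expsum v w (x - y))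
    (expsum v (fun k => B k *m w k) (x - y)).
Proof.
have Hl : is_derive x (1 : R) (fun x => x - y) 1.
  by apply: is_derive_eq; rewrite ?oppr0 ?addr0.
rewrite -[X in is_derive _ _ _ X]mulr1.
exact: (@is_derive1_comp _ (expsum v w) (fun x => x - y) x _ _
  (is_derive_expsum v w _) Hl).
Qed.

Hypothesis HB : forall k, is_subintensity (B k).

Lemma expsum_cvg0 v w (y : R) : expsum v w (x - y) @[x --> +oo] --> 0.
Proof.
have H : expsum v w x @[x --> +oo] --> 0.
  rewrite (_ : expsum v w = fun u => \sum_k \sum_l
      (\sum_l' v k 0 l' * expmx (u *: B k) l' l) * w k l 0); last first.
    apply/funext => u; rewrite /expsum summxE; apply: eq_bigr => k _.
    rewrite mxE; apply: eq_bigr => l _; by rewrite mxE.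
  apply: cvg_sum0 => k; apply: cvg_sum0 => l.
  rewrite -[X in _ --> X](mul0r (w k l 0)); apply: cvgMl.
  apply: cvg_sum0 => l'.
  rewrite -[X in _ --> X](mulr0 (v k 0 l')); apply: cvgMr.
  exact: expmx_cvg0.
suff Hy : (x - y : R) @[x --> +oo%R] --> +oo%R by exact: (cvg_comp _ _ Hy H).
apply/cvgryPge => A; near=> x; rewrite lerBrDr.
by near: x; apply: nbhs_pinfty_ge; rewrite num_real.
Unshelve. all: by end_near. Qed.

(** Replacing w by B^(-1) w gives a primitive that vanishes at infinity, so only the value at [c]
    remains. The sign condition is the one under which the fundamental theorem holds on an unbounded
    interval. *)
Lemma integral_expsum v w (y c : R) :
  (forall x, c <= x -> 0 <= expsum v w (x - y)) ->
  (\int[@lebesgue_measure R]_(x in `]c, +oo[) (expsum v w (x - y))%:E =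
    (- expsum v (fun k => invmx (B k) *m w k) (c - y))%:E)%E.
Proof.
move=> w0.
pose F x := expsum v (fun k => invmx (B k) *m w k) (x - y).
have dF x : is_derive x (1 : R) F (expsum v w (x - y)).
  rewrite (_ : w = fun k => B k *m (invmx (B k) *m w k)).
    exact: is_derive_expsum_shift.
  by apply/funext => k; rewrite mulKVmx// (sub_unit (HB k)).
have cf : continuous (fun x : R => expsum v w (x - y)).
  exact: is_derive_continuous (is_derive_expsum_shift v w y).
rewrite integral_itv_obnd_cbnd; last first.
  apply/measurable_EFinP/measurable_funTS; exact: continuous_measurable_fun.
rewrite (@ge0_continuous_FTC2y _ _ F _ 0).
- by rewrite sub0e EFinN.
- exact: w0.
- exact/continuous_subspaceT.
- exact: expsum_cvg0.
- by move=> x _; have [] := dF x.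
- apply: cvg_at_right_filter.
  exact: is_derive_continuous dF c.
- by move=> x _; rewrite derive1E; have [_] := dF x.
Qed.

End exponential_sums.

(** The middle matrix may depend on the regime because the rule serves twice: with H_2 it yields the
    primitive of [density1_tail], with [B^(k), H_2] the continuity of [density1_tail]. *)
Lemma is_derive_commutator (R : realType) m n (B H : 'I_m -> 'M[R]_n)
    (v : 'I_m -> 'rV[R]_n) (w : 'I_m -> 'cV[R]_n) (a b y : R) :
  is_derive y (1 : R)
    (fun y => (\sum_k v k *m expmx ((y - a) *: B k) *m H k
       *m expmx ((b - y) *: B k) *m w k) 0 0)
    ((\sum_k v k *m expmx ((y - a) *: B k) *m commutator (B k) (H k)
       *m expmx ((b - y) *: B k) *m w k) 0 0).
Proof.
suff D : mx_derive (fun y => \sum_k v k *m expmx ((y - a) *: B k) *m H k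
       *m expmx ((b - y) *: B k) *m w k) y
    (\sum_k v k *m expmx ((y - a) *: B k) *m commutator (B k) (H k)
       *m expmx ((b - y) *: B k) *m w k) by exact: D.
have Ha : is_derive y (1 : R) (fun x => x - a) 1.
  by apply: is_derive_eq; rewrite ?oppr0 ?addr0.
have Hb : is_derive y (1 : R) (fun x => b - x) (- 1).
  by have := is_deriveB (is_derive_cst b y (1 : R)) (is_derive_id y (1 : R)); rewrite sub0r.
apply: mx_derive_sum => k; apply: mx_derive_eq.
  apply: mx_derive_mul; last exact: mx_derive_cst.
  apply: mx_derive_mul; last first.
    apply: (@mx_derive_comp _ _ _ (fun u => expmx (u *: B k)) (fun x => b - x)).
    exact: mx_derive_exp.
  apply: mx_derive_mul; last exact: mx_derive_cst.
  apply: mx_derive_mul; first exact: mx_derive_cst.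
  apply: (@mx_derive_comp _ _ _ (fun u => expmx (u *: B k)) (fun x => x - a)).
  exact: mx_derive_exp.
rewrite !mulmx0 !mul0mx !addr0 add0r scale1r scaleN1r /commutator.
by rewrite mulmxBr mulmxN !mulmxBl expmxC !mulmxA.
Qed.

(** * The densities and their iterated integrals *)

(* [H] projects onto the states outside a set that the process cannot leave. *)
Record is_exit {R : realType} m n (B : 'I_m -> 'M[R]_n) (H : 'M[R]_n) : Prop := {
  exit_ge0 : mx_ge0 H ;
  exit_compl_ge0 : mx_ge0 (1%:M - H) ;
  exit_closed : forall k, B k *m H = H *m B k *m H ;
  exit_flux : forall k, mx_ge0 (H *m B k *m (1%:M - H)) }.

Section densities.
Context {R : realType} {m n : nat}.
Variable B : 'I_m -> 'M[R]_n.
Hypothesis HB : forall k, is_subintensity (B k).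

Let one : 'cV[R]_n := const_mx 1.

Lemma exit_commutator H k : is_exit B H ->
  commutator (B k) H = - (H *m B k *m (1%:M - H)).
Proof.
move=> eH; rewrite /commutator (exit_closed eH) mulmxBr mulmx1 opprB.
by [].
Qed.

(** The exit rate splits into direct absorption H(-B 1) and the flux H B (1-H) 1 into the transient
    part of the closed set. *)
Lemma exit_rate_ge0 H k : is_exit B H -> mx_ge0 (- (B k *m (H *m one))).
Proof.
move=> eH.
rewrite (_ : - _ = H *m - (B k *m one) + H *m B k *m (1%:M - H) *m one).
  apply: mx_ge0D; apply: mx_ge0M.
  - exact: exit_ge0 eH.
  - exact: sub_row (HB k).
  - exact: exit_flux eH k.
  - exact: mx_ge0_const.
rewrite mulmxBr mulmx1 mulmxBl mulmxN !mulmxA (exit_closed eH k).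
by rewrite addrA addNr add0r.
Qed.

Variables (H1 H2 : 'M[R]_n).
Hypothesis e1 : is_exit B H1.
Hypothesis e2 : is_exit B H2.
Hypothesis H12 : (1%:M - H1) *m (1%:M - H2) = 0.
Hypothesis H21 : (1%:M - H2) *m (1%:M - H1) = 0.

(** Applied to the all-ones vector, the right side is the rate of jumping straight to Delta from a
    state outside both sets; in this form the diagonal density is visibly nonnegative. *)
Lemma exit_diagonal k :
  commutator (B k) H2 *m H1 + commutator (B k) H1 *m H2 - B k *m H2 *m H1 =
  - (H1 *m H2 *m B k).
Proof.
(* From inside the first set no state of the second can be reached, except Delta: closedness gives
   (1-G) B = (1-G) B (1-G), hence (1-G) B (1-H) = 0. Expanding this product is the claim. *)
have E (G H : 'M[R]_n) : is_exit B G -> (1%:M - G) *m (1%:M - H) = 0 ->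
    G *m B k *m H = B k *m H + G *m B k - B k.
  move=> eG GH; have Z : (1%:M - G) *m B k *m (1%:M - H) = 0.
    rewrite (_ : _ *m B k = (1%:M - G) *m B k *m (1%:M - G)).
      by rewrite -mulmxA GH mulmx0.
    rewrite mulmxBr mulmx1 !mulmxBl !mul1mx -(exit_closed eG) subrr.
    by rewrite subr0.
  move: Z; rewrite !(mulmxBl, mulmxBr) !mul1mx !mulmx1 => /eqP.
  rewrite opprB addrA subr_eq0 => /eqP.
  move=> Z; rewrite -[LHS](addrK (B k)) -{}Z.
  by apply/matrixP => i j; rewrite !mxE; ring.
have E21 := E _ _ e2 H21; have E12 := E _ _ e1 H12.
have P12 : H1 *m H2 = H1 + H2 - 1%:M.
  move: H12; rewrite mulmxBl mul1mx mulmxBr mulmx1 => /eqP.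
  rewrite subr_eq0 => /eqP h.
  have -> : H1 *m H2 = H1 - (1%:M - H2) by rewrite h opprB addrCA subrr addr0.
  by rewrite opprB addrA.
have P21 : H2 *m H1 = H1 + H2 - 1%:M.
  move: H21; rewrite mulmxBl mul1mx mulmxBr mulmx1 => /eqP.
  rewrite subr_eq0 => /eqP h.
  have -> : H2 *m H1 = H2 - (1%:M - H1) by rewrite h opprB addrCA subrr addr0.
  by rewrite opprB addrA [H2 + _]addrC.
rewrite P12 /commutator !mulmxBl -!mulmxA P12 P21 !mulmxA.
rewrite !(mulmxDr, mulmxBr, mulmxDl, mulmxBl, mulmx1, mul1mx, mulmxN, mulNmx) E12 E21.
set b1 := B k *m H1; set b2 := B k *m H2; set b := B k.
set c1 := H1 *m b; set c2 := H2 *m b.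
rewrite !(opprD, opprB, opprK).
by apply/matrixP => i j; rewrite !mxE; ring.
Qed.


Variables (S : 'I_m -> 'M[R]_n) (i : 'I_n) (t : R).
Let v k : 'rV[R]_n := delta_mx ord0 i *m S k.
Hypothesis v0 : forall k, mx_ge0 (v k).

Let E k (u : R) : 'M[R]_n := expmx (u *: B k).

Let E0 k u : 0 <= u -> mx_ge0 (E k u).
Proof. by move=> u0; apply: expmx_ge0 => //; exact: sub_off (HB k). Qed.

Lemma density1E x y : density1 B H1 H2 S i t x y =
  expsum B (fun k => v k *m E k (y - t) *m commutator (B k) H2)
    (fun k => B k *m (H1 *m one)) (x - y).
Proof.
rewrite /density1 /expsum summxE; apply: eq_bigr => k _.
by rewrite !mulmxA.
Qed.

Lemma density0E x : density0 B H1 H2 S i t x =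
  expsum B v (fun k => H1 *m (H2 *m - (B k *m one))) (x - t).
Proof.
rewrite /density0 /expsum summxE; apply: eq_bigr => k _.
by rewrite exit_diagonal !(mulmxN, mulNmx) !mulmxA.
Qed.

Lemma density1_ge0 x y : t <= y -> y <= x -> 0 <= density1 B H1 H2 S i t x y.
Proof.
move=> ty yx; rewrite density1E /expsum summxE; apply: sumr_ge0 => k _.
rewrite exit_commutator// mulmxN !mulNmx -mulmxN.
apply: mx_ge0M; last exact: exit_rate_ge0.
apply: mx_ge0M; last by apply: E0; rewrite subr_ge0.
apply: mx_ge0M; last exact: exit_flux.
by apply: mx_ge0M => //; apply: E0; rewrite subr_ge0.
Qed.

Lemma density0_ge0 x : t <= x -> 0 <= density0 B H1 H2 S i t x.
Proof.
move=> tx; rewrite density0E /expsum summxE; apply: sumr_ge0 => k _.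
apply: mx_ge0M; first by apply: mx_ge0M => //; apply: E0; rewrite subr_ge0.
apply: mx_ge0M; first exact: exit_ge0 e1.
by apply: mx_ge0M; [exact: exit_ge0 e2|exact: sub_row (HB k)].
Qed.

(** The integral of [density1] over first times beyond [x], for t <= y <= x: the factor B^(k) of the
    density cancels against the inverse in the primitive. *)
Definition density1_tail (x y : R) : R := - (\sum_k v k *m E k (y - t) *m
  commutator (B k) H2 *m E k (x - y) *m (H1 *m one)) 0 0.

Lemma integral_density1_inner x y : t <= y -> y <= x ->
  (\int[@lebesgue_measure R]_(z in `]x, +oo[) (density1 B H1 H2 S i t z y)%:E
   = (density1_tail x y)%:E)%E.
Proof.
move=> ty yx; under eq_integral do rewrite density1E.
rewrite integral_expsum//; last first.
  by move=> z xz; rewrite -density1E density1_ge0// (le_trans yx).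
congr (- _)%:E; rewrite /expsum; congr (fun_of_matrix _ 0 0); apply: eq_bigr => k _.
by rewrite mulKmx// (sub_unit (HB k)).
Qed.

Let tail_ge0 x y : t <= y -> y <= x -> 0 <= density1_tail x y.
Proof.
move=> ty yx; rewrite -lee_fin -integral_density1_inner//.
apply: integral_ge0 => z /=; rewrite in_itv/= andbT => xz.
by rewrite lee_fin density1_ge0// (le_trans yx)// ltW.
Qed.

Let tail_diag y : density1_tail y y =
  expsum B v (fun k => - (commutator (B k) H2 *m (H1 *m one))) (y - t).
Proof.
rewrite expsumN /density1_tail; congr (- (fun_of_matrix _ 0 0)); apply: eq_bigr => k _.
by rewrite subrr /E expmx0 mulmx1 !mulmxA.
Qed.

Let continuous_tail b : continuous (density1_tail b).
Proof.
apply: is_derive_continuous => y.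
apply: is_deriveN.
exact: (is_derive_commutator B (fun k => commutator (B k) H2) v (fun=> H1 *m one)).
Qed.

(** The survival function on the side y <= x. The maximum freezes it for x < y at its value on the
    diagonal, so that [integral_tail] has one formula for both orders of its arguments. *)
Definition survival1 (x y : R) : R := (\sum_k v k *m E k (y - t) *m
  H2 *m E k (Num.max x y - y) *m (H1 *m one)) 0 0.

(** For c >= t this is the mass that [density1] gives to the triangle c < t_2 < t_1; [joint_mass]
    below is the value of the survival function at (c, c). *)
Definition exit_mass (c : R) : R :=
  expsum B v (fun k => invmx (B k) *m (commutator (B k) H2 *m (H1 *m one))) (c - t).

Definition joint_mass (c : R) : R :=
  expsum B v (fun k => H2 *m (H1 *m one)) (c - t).

Lemma integral_tail_bounded a b : t <= a -> a < b ->
  (\int[@lebesgue_measure R]_(y in `]a, b]) (density1_tail b y)%:E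
   = (survival1 b a - joint_mass b)%:E)%E.
Proof.
move=> ta ab.
have ct : continuous (density1_tail b) by exact: continuous_tail.
pose G (y : R) := (\sum_k v k *m expmx ((y - t) *: B k) *m H2
  *m expmx ((b - y) *: B k) *m (H1 *m one)) 0 0.
have dG y : is_derive y (1 : R) (- G) (density1_tail b y).
  exact: (is_deriveN (is_derive_commutator B (fun=> H2) v (fun=> H1 *m one) t b y)).
have cG : continuous (- G) := is_derive_continuous dG.
rewrite integral_itv_obnd_cbnd; last first.
  apply/measurable_EFinP/measurable_funTS; exact: continuous_measurable_fun.
have Gb : G b = joint_mass b.
  rewrite /joint_mass /G /expsum; congr (fun_of_matrix _ 0 0).
  by apply: eq_bigr => k _; rewrite subrr expmx0 mulmx1 !mulmxA.
have Ga : G a = survival1 b a.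
  rewrite /survival1 /G; congr (fun_of_matrix _ 0 0).
  by apply: eq_bigr => k _; rewrite max_l// ltW.
rewrite (continuous_FTC2 (F := - G) ab).
- have NG y : (- G) y = - G y by [].
  by rewrite !NG Gb Ga -EFinB opprK addrC.
- exact/continuous_subspaceT.
- split => [x _||]; first by have [] := dG x.
    exact/cvg_at_right_filter/cG.
  exact/cvg_at_left_filter/cG.
- by move=> x _; rewrite derive1E; have [_] := dG x.
Qed.

Lemma integral_tail_unbounded a : t <= a ->
  (\int[@lebesgue_measure R]_(y in `]a, +oo[) (density1_tail y y)%:E
   = (exit_mass a)%:E)%E.
Proof.
move=> ta; under eq_integral do rewrite tail_diag.
rewrite integral_expsum//; last first.
  by move=> y ay; rewrite -tail_diag tail_ge0// (le_trans ta).
congr _%:E; rewrite -expsumN /exit_mass /expsum; congr (fun_of_matrix _ 0 0).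
by apply: eq_bigr => k _; rewrite (mulmxN (invmx _)) opprK.
Qed.

(** The first time has to exceed both [a] and the second time y. Hence the integrand changes form at
    y = a: up to [a] it is the tail from [a], beyond [a] the tail taken on the diagonal. *)
Lemma integral_tail a b : t <= a -> t <= b ->
  (\int[@lebesgue_measure R]_(y in `]b, +oo[) (density1_tail (Num.max a y) y)%:E
   = (survival1 a b - joint_mass (Num.max a b) + exit_mass (Num.max a b))%:E)%E.
Proof.
move=> ta tb; have [ab|ba] := leP a b.
  rewrite (_ : survival1 a b = joint_mass b) ?subrr ?add0r; last first.
    rewrite /survival1 /joint_mass /expsum; congr (fun_of_matrix _ 0 0).
    by apply: eq_bigr => k _; rewrite max_r// subrr /E expmx0 mulmx1 !mulmxA.
  rewrite -(integral_tail_unbounded tb); apply: eq_integral => y.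
  rewrite inE/= in_itv/= andbT => yb.
  by rewrite max_r// (le_trans ab)// ltW.
rewrite (@itv_bndbnd_setU _ _ (BRight b) (BRight a) +oo%O)//; last by rewrite bnd_simp ltW.
have mab : measurable_fun `]b, a] (fun y : R => (density1_tail (Num.max a y) y)%:E).
  apply: (@eq_measurable_fun _ _ _ _ _ (EFin \o density1_tail a)) => [y|].
    by rewrite inE/= in_itv/= => /andP[_ ya]; rewrite max_l.
  apply/measurable_EFinP/measurable_funTS; apply: continuous_measurable_fun.
  exact: continuous_tail.
have may : measurable_fun `]a, +oo[ (fun y : R => (density1_tail (Num.max a y) y)%:E).
  apply: (@eq_measurable_fun _ _ _ _ _ (EFin \o (fun y : R => expsum B v
      (fun k => - (commutator (B k) H2 *m (H1 *m one))) (y - t)))) => [y|].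
    by rewrite inE/= in_itv/= andbT => ay; rewrite max_r ?tail_diag// ltW.
  apply/measurable_EFinP/measurable_funTS; apply: continuous_measurable_fun.
  exact: is_derive_continuous (is_derive_expsum_shift B v _ t).
rewrite ge0_integral_setU//=; last 3 first.
- exact/measurable_funU.
- move=> y yab; rewrite lee_fin tail_ge0//; last by rewrite le_max lexx orbT.
  apply: (le_trans tb); apply: ltW; move: yab => /=.
  rewrite !in_itv/= andbT => -[/andP[]//|]; exact: lt_trans.
- apply/disj_setPS => y [/=]; rewrite !in_itv/= andbT => /andP[_ ya] ay.
  by move: (le_lt_trans ya ay); rewrite ltxx.
rewrite [X in (X + _)%E](_ : _ = (survival1 a b - joint_mass a)%:E); last first.
  rewrite -(integral_tail_bounded tb ba); apply: eq_integral => y.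
  by rewrite inE/= in_itv/= => /andP[_ ya]; rewrite max_l.
rewrite [X in (_ + X)%E](_ : _ = (exit_mass a)%:E); last first.
  rewrite -(integral_tail_unbounded ta); apply: eq_integral => y.
  by rewrite inE/= in_itv/= andbT => ya; rewrite max_r// ltW.
by rewrite -EFinD.
Qed.

End densities.

(** * Measures on the plane *)

Lemma density_measure d (T : measurableType d) (R : realType)
    (mu : {measure set T -> \bar R}) (D : set T) (f : T -> R) :
  measurable D -> measurable_fun D f -> (forall x, D x -> 0 <= f x) ->
  exists nu : {measure set T -> \bar R}, forall A,
    (nu A = \int[mu]_(x in A `&` D) (f x)%:E)%E.
Proof.
move=> mD mf f0; pose g := (EFin \o f) \_ D.
have mg : measurable_fun setT g.
  apply/(measurable_restrictT _ _).1 => //; exact/measurable_EFinP.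
have g0 x : (0 <= g x)%E.
  by rewrite /g patchE; case: ifPn => // /set_mem Dx; rewrite lee_fin f0.
pose nu A := (\int[mu]_(x in A) g x)%E.
have nu0 : nu set0 = 0%E by rewrite /nu integral_set0.
have nu_ge0 A : (0 <= nu A)%E by apply: integral_ge0.
pose M := isMeasure.Build _ T R nu nu0 nu_ge0
  (@semi_sigma_additive_nng_induced _ _ _ mu _ mg g0).
exists (HB.pack_for {measure set T -> \bar R} nu M) => A /=.
by rewrite /nu integral_mkcondr.
Qed.

(** Normalization leaves a measure of mass 1 unchanged and supplies the type of a probability;
    [dirac point] is its default value for mass 0 or infinity. *)
Lemma probability_of_measure d (T : measurableType d) (R : realType)
    (mu : {measure set T -> \bar R}) : (mu setT = 1)%E ->
  exists P : probability T R, forall A, P A = mu A.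
Proof.
move=> mu1; pose P0 : probability T R := dirac point.
exists (mnormalize mu P0) => A /=.
by rewrite /mnormalize mu1/= onee_eq0/= invr1 mule1.
Qed.

Section quadrants.
Context {R : realType}.
Local Notation plane := (measurableTypeR R * measurableTypeR R)%type.

Definition quadrant (x y : R) : set plane := [set z | x < z.1 /\ y < z.2].

Lemma quadrantE x y : quadrant x y = `]x, +oo[ `*` `]y, +oo[.
Proof. by apply/seteqP; split => z /=; rewrite !in_itv/= !andbT. Qed.

Lemma measurable_quadrant x y : measurable (quadrant x y).
Proof. by rewrite quadrantE; apply: measurableX => //; exact: measurable_itv. Qed.

Definition quadrants : set (set plane) :=
  [set A | exists x y, A = quadrant x y].

Lemma setI_closed_quadrants : setI_closed quadrants.
Proof.
move=> _ _ [x [y ->]] [x' [y' ->]]; exists (Num.max x x'), (Num.max y y').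
apply/seteqP; split => z /=; rewrite /quadrant/= !gt_max.
  by move=> [[-> ->] [-> ->]].
by move=> [/andP[-> ->] /andP[-> ->]].
Qed.

Lemma bigcup_quadrant_l x : `]x, +oo[ `*` setT = \bigcup_k quadrant x (- k%:R).
Proof.
apply/seteqP; split => [z [/= + _]|z [k _ [xz _]]]; last first.
  by split => //=; rewrite in_itv/= andbT.
rewrite in_itv/= andbT => xz; exists (Num.bound `|z.2|) => //; split => //=.
by rewrite ltrNl (le_lt_trans (ler_norm _))// normrN archi_boundP.
Qed.

Lemma bigcup_quadrant_r y : setT `*` `]y, +oo[ = \bigcup_k quadrant (- k%:R) y.
Proof.
apply/seteqP; split => [z [/= _ +]|z [k _ [_ yz]]]; last first.
  by split => //=; rewrite in_itv/= andbT.
rewrite in_itv/= andbT => yz; exists (Num.bound `|z.1|) => //; split => //=.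
by rewrite ltrNl (le_lt_trans (ler_norm _))// normrN archi_boundP.
Qed.

(** Half-planes are countable unions of quadrants, so both projections are measurable for the
    generated sigma-algebra, and with them all rectangles. *)
Lemma measurable_quadrants : @measurable _ plane = <<s quadrants >>.
Proof.
apply/seteqP; split; last first.
  apply: smallest_sub; first exact: sigma_algebra_measurable.
  by move=> _ [x [y ->]]; exact: measurable_quadrant.
have m1 : measurable_fun setT (fst : g_sigma_algebraType quadrants -> measurableTypeR R).
  apply: (measurability _ (RGenOInfty.measurableE R)) => // _ [_ [x ->] <-].
  rewrite setTI (_ : _ @^-1` _ = `]x, +oo[ `*` setT); last first.
    by apply/seteqP; split => z /= => [|[]].
  rewrite bigcup_quadrant_l; apply: bigcupT_measurable => k.
  by apply: sub_sigma_algebra; do 2 eexists.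
have m2 : measurable_fun setT (snd : g_sigma_algebraType quadrants -> measurableTypeR R).
  apply: (measurability _ (RGenOInfty.measurableE R)) => // _ [_ [x ->] <-].
  rewrite setTI (_ : _ @^-1` _ = setT `*` `]x, +oo[); last first.
    by apply/seteqP; split => z /= => [|[]].
  rewrite bigcup_quadrant_r; apply: bigcupT_measurable => k.
  by apply: sub_sigma_algebra; do 2 eexists.
rewrite measurable_prod_measurableType; apply: smallest_sub.
  exact: smallest_sigma_algebra.
move=> _ [A mA [B mB <-]]; rewrite (_ : A `*` B = fst @^-1` A `&` snd @^-1` B)//.
apply: (@measurableI _ (g_sigma_algebraType quadrants)).
  by rewrite -[X in measurable X]setTI; exact: m1.
by rewrite -[X in measurable X]setTI; exact: m2.
Qed.

Lemma eq_measure_quadrants (mu nu : {measure set plane -> \bar R}) :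
  (forall k, (mu (quadrant (- k%:R) (- k%:R)) < +oo)%E) ->
  (forall x y, mu (quadrant x y) = nu (quadrant x y)) ->
  forall A, measurable A -> mu A = nu A.
Proof.
move=> muoo munu; apply: (measure_unique quadrants (fun k => quadrant (- k%:R) (- k%:R))) => //.
- exact: measurable_quadrants.
- exact: setI_closed_quadrants.
- by move=> k; do 2 eexists.
- apply/seteqP; split => // z _; exists (Num.bound (Num.max `|z.1| `|z.2|)) => //.
  have H := archi_boundP (_ : 0 <= Num.max `|z.1| `|z.2|).
  have {}H := H ltac:(by rewrite le_max normr_ge0).
  split => /=; rewrite ltrNl (le_lt_trans (ler_norm _))// normrN;
    by apply: le_lt_trans H; rewrite le_max lexx ?orbT.
- by move=> _ [x [y ->]].
Qed.

End quadrants.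

(** * A law on the support is determined by its survival function at rational offsets *)

Section survival_uniqueness.
Context {R : realType}.
Local Notation plane := (measurableTypeR R * measurableTypeR R)%type.
Implicit Types mu nu : probability plane R.

(** The shrunken quadrants F_k increase to the given one, and a rational quadrant fits between F_k
    and it. Stating an inequality means that a limit is taken for [mu] only; exchanging the two
    measures gives equality. *)
Lemma le_measure_quadrants_dense (t : R) mu nu :
  (forall p q : rat, 0 <= p -> 0 <= q ->
    (mu (quadrant (t + ratr p) (t + ratr q)) <=
     nu (quadrant (t + ratr p) (t + ratr q)))%E) ->
  forall x y, t <= x -> t <= y -> (mu (quadrant x y) <= nu (quadrant x y))%E.
Proof.
move=> munu x y tx ty.
pose F k := quadrant (x + k.+1%:R^-1) (y + k.+1%:R^-1).
have UF : \bigcup_k F k = quadrant x y.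
  apply/seteqP; split => [z [k _ [/= xz yz]]|z [/= xz yz]].
    by split => /=; [apply: le_lt_trans xz|apply: le_lt_trans yz];
      rewrite lerDl invr_ge0.
  have e0 : 0 < Num.min (z.1 - x) (z.2 - y) by rewrite lt_min !subr_gt0 xz.
  have [k ke] := ltr_add_invr e0.
  exists k => //; move: ke; rewrite add0r lt_min => /andP[k1 k2].
  by split; rewrite /= -ltrBrDl.
have cF : mu (F k) @[k --> \oo] --> mu (quadrant x y).
  rewrite -UF; apply: nondecreasing_cvg_mu.
  - by move=> k; exact: measurable_quadrant.
  - by rewrite UF; exact: measurable_quadrant.
  - move=> k l kl; apply/subsetPset => z [/= xz yz].
    have lk : l.+1%:R^-1 <= k.+1%:R^-1 :> R by rewrite lef_pV2 ?posrE// ler_nat.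
    by split => /=; [apply: le_lt_trans xz|apply: le_lt_trans yz];
      rewrite lerD2l.
rewrite -(cvg_lim _ cF)//; apply: lime_le; first by apply/cvg_ex; eexists; exact: cF.
apply: nearW => k.
have rat_between (c : R) : t <= c ->
    exists2 p : rat, 0 <= p & c < t + ratr p < c + k.+1%:R^-1.
  move=> tc; have := @rat_in_itvoo R (c - t) (c - t + k.+1%:R^-1).
  rewrite ltrDl invr_gt0 ltr0n => /(_ isT)[p]; rewrite in_itv/= => /andP[p1 p2].
  exists p; last by rewrite -ltrBlDl p1 -ltrBrDl addrAC.
  by rewrite -(@ler0q R) (le_trans _ (ltW p1))// subr_ge0.
have [p p0 /andP[xp px]] := rat_between x tx.
have [q q0 /andP[yq qy]] := rat_between y ty.
apply: (@le_trans _ _ (mu (quadrant (t + ratr p) (t + ratr q)))).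
  apply: le_measure; rewrite ?inE; try exact: measurable_quadrant.
  by move=> z [/= z1 z2]; split; [exact: lt_trans z1|exact: lt_trans z2].
apply: le_trans (munu _ _ p0 q0) _.
apply: le_measure; rewrite ?inE; try exact: measurable_quadrant.
by move=> z [/= z1 z2]; split; [exact: lt_trans z1|exact: lt_trans z2].
Qed.

Definition survival_support (t : R) : set plane :=
  [set (t, t)] `|` [set z | t < z.1 /\ t < z.2].

Lemma measurable_survival_support t : measurable (survival_support t).
Proof.
apply: measurableU; last exact: measurable_quadrant.
rewrite (_ : [set _] = [set t] `*` [set t]); first exact: measurableX.
by apply/seteqP; split => [_ -> //|[a b] [/= -> ->]].
Qed.

Lemma eq_survival_measure (t : R) mu nu :
  mu (~` survival_support t) = 0%E -> nu (~` survival_support t) = 0%E ->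
  (forall p q : rat, 0 <= p -> 0 <= q ->
    mu (quadrant (t + ratr p) (t + ratr q)) =
    nu (quadrant (t + ratr p) (t + ratr q))) ->
  forall A, measurable A -> mu A = nu A.
Proof.
move=> mu0 nu0 munu.
have supp (m : probability plane R) A : m (~` survival_support t) = 0%E ->
    measurable A -> m A = m (A `&` survival_support t).
  move=> m0 mA; have mS := measurable_survival_support t.
  rewrite (measureDI m mA mS).
  rewrite [X in (X + _)%E](_ : _ = 0%E) ?add0e//.
  apply: (subset_measure0 _ _ _ m0); [exact: measurableD|exact: measurableC|].
  by move=> z [].
have H x y : t <= x -> t <= y -> mu (quadrant x y) = nu (quadrant x y).
  move=> tx ty; apply/eqP; rewrite eq_le.
  by apply/andP; split; apply: le_measure_quadrants_dense tx ty => p q p0 q0;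
    rewrite munu.
apply: eq_measure_quadrants => [k|x y].
  by rewrite ltey_eq fin_num_measure//; exact: measurable_quadrant.
apply: (etrans (supp mu _ mu0 (measurable_quadrant x y))).
apply: esym; apply: (etrans (supp nu _ nu0 (measurable_quadrant x y))); apply: esym.
(* The atom (t, t) belongs to the quadrant exactly in the first case, and then the quadrant contains
   the whole support, of mass 1. Otherwise its trace on the support is a quadrant with corner in [t,
   oo)^2. *)
have [xyt|xyt] := boolP ((x < t) && (y < t)).
  rewrite (_ : _ `&` _ = setT `&` survival_support t).
    apply: (etrans (esym (supp mu _ mu0 measurableT))).
    apply: esym; apply: (etrans (esym (supp nu _ nu0 measurableT))).
    by rewrite !probability_setT.
  move: xyt => /andP[xt yt]; rewrite setTI; apply: setIidr.
  move=> z [->//|/= [z1 z2]]; split => /=; [exact: lt_trans z1|exact: lt_trans z2].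
rewrite (_ : _ `&` _ = quadrant (Num.max x t) (Num.max y t)).
  by apply: H; rewrite le_max lexx orbT.
apply/seteqP; split => [z [[/= xz yz] [zt|[tz1 tz2]]]|z [/=]].
- by move: xyt xz yz; rewrite zt/= => /negP xyt xt yt; exfalso; apply/xyt/andP.
- by split; rewrite /= gt_max ?xz ?yz.
- by rewrite !gt_max => /andP[xz tz] /andP[yz tz']; split; [split|right; split].
Qed.

End survival_uniqueness.

(** * Tonelli's theorem on the two triangles of a quadrant *)

Section triangles.
Context {R : realType}.
Local Notation plane := (measurableTypeR R * measurableTypeR R)%type.
Local Notation lam := (@lebesgue_measure R).
Variables (f : R -> R -> R) (g : R -> R).

Lemma measurable_lower_half : measurable [set z : plane | z.2 < z.1].
Proof.
have := @measurable_fun_ltr _ plane R setT snd fst measurable_snd measurable_fst.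
by move=> /(_ measurableT [set true]); rewrite setTI; exact.
Qed.

Lemma measurable_upper_half : measurable [set z : plane | z.1 < z.2].
Proof.
have := @measurable_fun_ltr _ plane R setT fst snd measurable_fst measurable_snd.
by move=> /(_ measurableT [set true]); rewrite setTI; exact.
Qed.

Let restriction_fst (x y a b : R) : (((EFin \o (fun z : plane => f z.1 z.2)) \_
      (quadrant x y `&` [set z | (z.2 < z.1)%R])) (a, b) =
  if (y < b)%R then ((fun c => (f c b)%:E) \_ `]Num.max x b, +oo[) a else 0)%E.
Proof.
rewrite !patchE; case: ifPn => [/set_mem[[/= xa yb] ba]|].
  by rewrite yb mem_set//= in_itv/= andbT gt_max xa.
move=> /negP nab; case: ifPn => // yb; case: ifPn => // /set_mem/=.
rewrite in_itv/= andbT gt_max => /andP[xa ba]; exfalso; apply: nab.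
by apply/mem_set.
Qed.

Let restriction_snd (x y a b : R) : (((EFin \o (fun z : plane => f z.2 z.1)) \_
      (quadrant x y `&` [set z | (z.1 < z.2)%R])) (a, b) =
  if (x < a)%R then ((fun c => (f c a)%:E) \_ `]Num.max y a, +oo[) b else 0)%E.
Proof.
rewrite !patchE; case: ifPn => [/set_mem[[/= xa yb] ba]|].
  by rewrite xa mem_set//= in_itv/= andbT gt_max yb.
move=> /negP nab; case: ifPn => // yb; case: ifPn => // /set_mem/=.
rewrite in_itv/= andbT gt_max => /andP[xa ba]; exfalso; apply: nab.
by apply/mem_set.
Qed.

Lemma integral_triangle_fst x y :
  measurable_fun setT (fun z : plane => f z.1 z.2) ->
  (forall a b, x < a -> y < b -> b < a -> 0 <= f a b) ->
  (forall b : R, (y < b)%R -> \int[lam]_(a in `]Num.max x b, +oo[) (f a b)%:E = (g b)%:E)%E ->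
  (\int[(lam \x lam)]_(z in quadrant x y `&` [set z | (z.2 < z.1)%R]) (f z.1 z.2)%:E
   = \int[lam]_(b in `]y, +oo[) (g b)%:E)%E.
Proof.
move=> mf f0 fg; rewrite integral_mkcond (@fubini_tonelli2 _ _ _ _ _ lam lam).
- rewrite [RHS]integral_mkcond; apply: eq_integral => /= b _.
  rewrite /fubini_G /=; under eq_integral do rewrite restriction_fst.
  rewrite [RHS]patchE; have [yb|yb] := ltP (y : R) b.
    by rewrite mem_set/= ?in_itv/= ?yb// -integral_mkcond fg.
  by rewrite integral0 memNset//= in_itv/= andbT; apply/negP; rewrite -leNgt.
- apply/(measurable_restrictT _ _).1.
    exact: measurableI (measurable_quadrant _ _) measurable_lower_half.
  by apply: measurable_funTS; exact/measurable_EFinP.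
- move=> [a b]; rewrite restriction_fst; case: ifPn => // yb; rewrite patchE.
  case: ifPn => // /set_mem; rewrite /= in_itv/= andbT gt_max => /andP[xa ba].
  by rewrite lee_fin f0.
Qed.

(** The integrand is f at (z.2, z.1), so the inner integral is again over the first argument of [f]
    and [integral_density1_inner] serves both triangles. *)
Lemma integral_triangle_snd x y :
  measurable_fun setT (fun z : plane => f z.2 z.1) ->
  (forall a b, y < a -> x < b -> b < a -> 0 <= f a b) ->
  (forall b : R, (x < b)%R -> \int[lam]_(a in `]Num.max y b, +oo[) (f a b)%:E = (g b)%:E)%E ->
  (\int[(lam \x lam)]_(z in quadrant x y `&` [set z | (z.1 < z.2)%R]) (f z.2 z.1)%:E
   = \int[lam]_(b in `]x, +oo[) (g b)%:E)%E.
Proof.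
move=> mf f0 fg; rewrite integral_mkcond (@fubini_tonelli1 _ _ _ _ _ lam).
- rewrite [RHS]integral_mkcond; apply: eq_integral => /= b _.
  rewrite /fubini_F /=; under eq_integral do rewrite restriction_snd.
  rewrite [RHS]patchE; have [xb|xb] := ltP (x : R) b.
    by rewrite mem_set/= ?in_itv/= ?xb// -integral_mkcond fg.
  by rewrite integral0 memNset//= in_itv/= andbT; apply/negP; rewrite -leNgt.
- apply/(measurable_restrictT _ _).1.
    exact: measurableI (measurable_quadrant _ _) measurable_upper_half.
  by apply: measurable_funTS; exact/measurable_EFinP.
- move=> [a b]; rewrite restriction_snd; case: ifPn => // xa; rewrite patchE.
  case: ifPn => // /set_mem; rewrite /= in_itv/= andbT gt_max => /andP[yb ab].
  by rewrite lee_fin f0.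
Qed.

End triangles.

Section measurable_matrices.
Context {d : measure_display} {T : measurableType d} {R : realType}.

Definition mx_measurable p q (M : T -> 'M[R]_(p, q)) : Prop :=
  forall i j, measurable_fun setT (fun w => M w i j).

Lemma mx_measurable_cst p q (M : 'M[R]_(p, q)) : mx_measurable (fun=> M).
Proof. by move=> i j; exact: measurable_cst. Qed.

Lemma mx_measurable_mul p q r (M : T -> 'M[R]_(p, q)) (N : T -> 'M[R]_(q, r)) :
  mx_measurable M -> mx_measurable N -> mx_measurable (fun w => M w *m N w).
Proof.
move=> mM mN i j.
rewrite (_ : (fun w => _) = fun w => \sum_l M w i l * N w l j); last first.
  by apply/funext => w; rewrite mxE.
by apply: measurable_sum => l; exact: measurable_funM.
Qed.

Lemma mx_measurable_exp n (A : 'M[R]_n) (f : T -> R) :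
  measurable_fun setT f -> mx_measurable (fun w => expmx (f w *: A)).
Proof.
move=> mf i j.
have cA : continuous (fun u : R => expmx (u *: A) i j).
  exact: is_derive_continuous (fun u => mx_derive_exp A u i j).
exact: (measurableT_comp (continuous_measurable_fun cA) mf).
Qed.

End measurable_matrices.

(** * Construction of the law with the stated density *)

Section joint_law_existence.
Context {R : realType} {m n : nat}.
Local Notation plane := (measurableTypeR R * measurableTypeR R)%type.
Local Notation lam := (@lebesgue_measure R).
Variable B : 'I_m -> 'M[R]_n.
Variables (S : 'I_m -> 'M[R]_n) (i : 'I_n) (t : R).

Lemma measurable_density1 (H1 H2 : 'M[R]_n) :
  measurable_fun setT (fun z : plane => density1 B H1 H2 S i t z.1 z.2).
Proof.
apply: measurable_sum => k.
suff : mx_measurable (fun z : plane => (delta_mx ord0 i : 'rV_n) *m S k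
    *m expmx ((z.2 - t) *: B k) *m commutator (B k) H2
    *m expmx ((z.1 - z.2) *: B k) *m B k *m H1 *m (const_mx 1 : 'cV_n)) by apply.
do 3!(apply: mx_measurable_mul; last exact: mx_measurable_cst).
apply: mx_measurable_mul; last first.
  apply: mx_measurable_exp; apply: measurable_funB.
    exact: measurable_fst.
  exact: measurable_snd.
apply: mx_measurable_mul; last exact: mx_measurable_cst.
apply: mx_measurable_mul; first exact: mx_measurable_cst.
apply: mx_measurable_exp; apply: measurable_funB; last exact: measurable_cst.
exact: measurable_snd.
Qed.

(** By definition [density2] is [density1] with the two matrices and the two times exchanged. *)
Lemma measurable_density2 (H1 H2 : 'M[R]_n) :
  measurable_fun setT (fun z : plane => density2 B H1 H2 S i t z.1 z.2).
Proof.
exact: (measurableT_comp (measurable_density1 H2 H1)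
  (measurable_swap (T1 := measurableTypeR R) (T2 := measurableTypeR R))).
Qed.

Lemma measurable_density0 (H1 H2 : 'M[R]_n) :
  measurable_fun setT (fun x : measurableTypeR R => density0 B H1 H2 S i t x).
Proof.
apply: measurable_sum => k.
suff : mx_measurable (fun x : measurableTypeR R => (delta_mx ord0 i : 'rV_n) *m S k
    *m expmx ((x - t) *: B k) *m
    (commutator (B k) H2 *m H1 + commutator (B k) H1 *m H2 - B k *m H2 *m H1)
    *m (const_mx 1 : 'cV_n)) by apply.
do 2!(apply: mx_measurable_mul; last exact: mx_measurable_cst).
apply: mx_measurable_mul; first exact: mx_measurable_cst.
by apply: mx_measurable_exp; apply: measurable_funB.
Qed.

Lemma measurable_joint_density (H1 H2 : 'M[R]_n) :
  measurable_fun setT (fun z : plane => joint_density B H1 H2 S i t z.1 z.2).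
Proof.
have m1 : measurable_fun setT (fst : plane -> R) by exact: measurable_fst.
have m2 : measurable_fun setT (snd : plane -> R) by exact: measurable_snd.
have mt : measurable_fun setT (fun _ : plane => t) by exact: measurable_cst.
rewrite /joint_density; apply: measurable_fun_ifT.
- by apply: measurable_and; exact: measurable_fun_ltr.
- exact: measurable_density1.
apply: measurable_fun_ifT.
- by apply: measurable_and; exact: measurable_fun_ltr.
- exact: measurable_density2.
apply: measurable_fun_ifT.
- by apply: measurable_and; [exact: measurable_fun_eqr|exact: measurable_fun_ltr].
- exact: (measurableT_comp (measurable_density0 H1 H2) m1).
apply: measurable_fun_ifT.
- by apply: measurable_and; exact: measurable_fun_eqr.
- exact: measurable_cst.
exact: measurable_cst.
Qed.

Variables (H1 H2 : 'M[R]_n).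
Hypothesis HB : forall k, is_subintensity (B k).
Hypothesis e1 : is_exit B H1.
Hypothesis e2 : is_exit B H2.
Hypothesis H12 : (1%:M - H1) *m (1%:M - H2) = 0.
Hypothesis H21 : (1%:M - H2) *m (1%:M - H1) = 0.
Hypothesis v0 : forall k, mx_ge0 ((delta_mx ord0 i : 'rV_n) *m S k).
Hypothesis v1 : \sum_k (delta_mx ord0 i : 'rV_n) *m S k = delta_mx ord0 i.

Let f := joint_density B H1 H2 S i t.

Let joint_density_lower x y : t < y -> y < x -> f x y = density1 B H1 H2 S i t x y.
Proof. by move=> ty yx; rewrite /f /joint_density ty yx. Qed.

Let joint_density_upper x y : t < x -> x < y -> f x y = density1 B H2 H1 S i t y x.
Proof.
by move=> tx xy; rewrite /f /joint_density tx xy (ltNge y) (ltW xy)/= andbF.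
Qed.

Let joint_density_diag x : t < x -> f x x = density0 B H1 H2 S i t x.
Proof. by move=> tx; rewrite /f /joint_density tx ltxx eqxx. Qed.

Let joint_density_atom : f t t = atom_mass H1 H2 i.
Proof. by rewrite /f /joint_density ltxx eqxx. Qed.

Let one : 'cV[R]_n := const_mx 1.

Lemma exit_diagC : H1 *m H2 = H2 *m H1.
Proof.
move: H12; rewrite -{}H21 !mulmxBl !mul1mx !mulmxBr !mulmx1 => /matrixP H.
by apply/matrixP => a b; have := H a b; rewrite !mxE; lra.
Qed.

(** Telescoping: 1 - H_2 H_1 = (1 - H_2) + H_2 (1 - H_1), with both terms entrywise nonnegative. *)
Lemma atom_mass_ge0 : 0 <= atom_mass H1 H2 i.
Proof.
pose e : 'rV[R]_n := delta_mx ord0 i.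
have e0 : mx_ge0 e by move=> a b; rewrite mxE ler0n.
have e11 : (e *m one) 0 0 = 1.
  rewrite mxE (bigD1 i)//= big1 ?addr0 => [|l li]; rewrite !mxE ?eqxx ?mulr1//.
  by rewrite (negbTE li).
have : 0 <= (e *m (1%:M - H2) *m one + e *m H2 *m (1%:M - H1) *m one) 0 0.
  apply: mx_ge0D; apply: mx_ge0M; try exact: mx_ge0_const.
    by apply: mx_ge0M => //; exact: exit_compl_ge0 e2.
  apply: mx_ge0M; last exact: exit_compl_ge0 e1.
  by apply: mx_ge0M => //; exact: exit_ge0 e2.
rewrite !mulmxBr !mulmx1 !mulmxBl addrA subrK mxE [X in _ + X]mxE e11.
by [].
Qed.

Lemma joint_density_ge0 x y : (t < x /\ t < y) \/ (x = t /\ y = t) -> 0 <= f x y.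
Proof.
move=> [[tx ty]|[-> ->]]; last by rewrite joint_density_atom atom_mass_ge0.
have [xy|yx|<-] := ltgtP x y.
- by rewrite joint_density_upper// density1_ge0// ltW.
- by rewrite joint_density_lower// density1_ge0// ltW.
- by rewrite joint_density_diag// density0_ge0// ltW.
Qed.

Definition survival (x y : R) : R :=
  if y <= x then survival1 B H1 H2 S i t x y else survival1 B H2 H1 S i t y x.

Let density0_mass (c : R) : R := - expsum B (fun k => (delta_mx ord0 i : 'rV_n) *m S k)
  (fun k => invmx (B k) *m (H1 *m (H2 *m - (B k *m one)))) (c - t).

Lemma integral_density0 c : t <= c ->
  (\int[lam]_(x in `]c, +oo[) (density0 B H1 H2 S i t x)%:E = (density0_mass c)%:E)%E.
Proof.
move=> tc.
have E x : density0 B H1 H2 S i t x = expsum B (fun k => (delta_mx ord0 i : 'rV_n) *m S k)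
    (fun k => H1 *m (H2 *m - (B k *m one))) (x - t) by exact: density0E.
under eq_integral do rewrite E.
rewrite integral_expsum// => x cx; rewrite -E.
by apply: density0_ge0 => //; exact: le_trans cx.
Qed.

(** Mass surviving jointly up to [c] lies beyond [c] in one of the two triangles or on the diagonal.
    Algebraically this is [exit_diagonal], rearranged and multiplied by B^(-1). *)
Lemma exit_mass_balance c :
  exit_mass B H1 H2 S i t c + exit_mass B H2 H1 S i t c + density0_mass c =
  joint_mass B H1 H2 S i t c.
Proof.
rewrite /exit_mass /density0_mass /joint_mass -expsumN -!expsumD /expsum.
congr (fun_of_matrix _ 0 0); apply: eq_bigr => k _; congr (_ *m _).
rewrite -(mulKmx (sub_unit (HB k)) (H2 *m (H1 *m one))) -mulmxN -!mulmxDr; congr (_ *m _).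
have := exit_diagonal e1 e2 H12 H21 k => /(congr1 (mulmx^~ one)).
rewrite !mulmxDl !mulNmx -!mulmxA => D.
apply/matrixP => a b; have := congr1 (fun M : 'cV_n => M a b) D.
by rewrite !mulmxN !mxE; lra.
Qed.

Lemma joint_massC c : joint_mass B H1 H2 S i t c = joint_mass B H2 H1 S i t c.
Proof.
rewrite /joint_mass /expsum; congr (fun_of_matrix _ 0 0); apply: eq_bigr => k _.
by rewrite !mulmxA -[_ *m H2 *m H1]mulmxA -exit_diagC mulmxA.
Qed.

Let survival1_diag (G H : 'M[R]_n) x y : x <= y ->
  survival1 B G H S i t x y = joint_mass B G H S i t y.
Proof.
move=> xy; rewrite /survival1 /joint_mass /expsum; congr (fun_of_matrix _ 0 0).
by apply: eq_bigr => k _; rewrite max_r// subrr expmx0 mulmx1 !mulmxA.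
Qed.

Lemma quadrant_mass x y : t <= x -> t <= y ->
  (\int[lam]_(b in `]y, +oo[) (density1_tail B H1 H2 S i t (Num.max x b) b)%:E
   + \int[lam]_(b in `]x, +oo[) (density1_tail B H2 H1 S i t (Num.max y b) b)%:E
   + \int[lam]_(b in `]Num.max x y, +oo[) (density0 B H1 H2 S i t b)%:E
   = (survival x y)%:E)%E.
Proof.
move=> tx ty; rewrite !integral_tail// integral_density0; last by rewrite le_max tx.
rewrite -!EFinD (maxC y x) -(joint_massC (Num.max x y)); congr _%:E.
have M := exit_mass_balance (Num.max x y).
(* The balance absorbs the exit masses, the diagonal mass and one of the two copies of [joint_mass].
   The remaining copy cancels the [survival1] whose first argument is the smaller time. *)
transitivity (survival1 B H1 H2 S i t x y + survival1 B H2 H1 S i t y x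
  - joint_mass B H1 H2 S i t (Num.max x y)); first by lra.
rewrite /survival; have [yx|xy] := leP y x.
  by rewrite (survival1_diag _ _ yx) -joint_massC addrK.
by rewrite (survival1_diag _ _ (ltW xy)) addrAC subrr add0r.
Qed.

Let off_diagonal : set plane := [set z | [/\ t < z.1, t < z.2 & z.1 != z.2]].

Let off_diagonalI x y : t <= x -> t <= y -> quadrant x y `&` off_diagonal =
  (quadrant x y `&` [set z | z.2 < z.1]) `|` (quadrant x y `&` [set z | z.1 < z.2]).
Proof.
move=> tx ty; rewrite -setIUr; apply/seteqP; split => z [Q /=].
  by move=> [_ _]; rewrite neq_lt => /orP[|]; split => //; [right|left].
move=> zz; split => //; split; [exact: le_lt_trans tx Q.1|exact: le_lt_trans ty Q.2|].
by rewrite neq_lt; apply/orP; case: zz; [right|left].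
Qed.

Let measurable_off_diagonal : measurable off_diagonal.
Proof.
rewrite (_ : off_diagonal = quadrant t t `&` off_diagonal).
  rewrite off_diagonalI//; apply: measurableU; apply: measurableI;
    [exact: measurable_quadrant|exact: measurable_lower_half|
     exact: measurable_quadrant|exact: measurable_upper_half].
by apply/esym/setIidr => z [].
Qed.

Let integral_off_diagonal x y : t <= x -> t <= y ->
  (\int[(lam \x lam)]_(z in quadrant x y `&` off_diagonal) (f z.1 z.2)%:E =
   \int[lam]_(b in `]y, +oo[) (density1_tail B H1 H2 S i t (Num.max x b) b)%:E
   + \int[lam]_(b in `]x, +oo[) (density1_tail B H2 H1 S i t (Num.max y b) b)%:E)%E.
Proof.
move=> tx ty; rewrite off_diagonalI// ge0_integral_setU//=; last first.
- apply/disj_setPS => z [[_ /= z1] [_ /= z2]].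
  by have := lt_trans z1 z2; rewrite ltxx.
- by move=> z [[[xz yz] _]|[[xz yz] _]]; rewrite lee_fin; apply: joint_density_ge0;
    left; split; [exact: le_lt_trans xz|exact: le_lt_trans yz|
                  exact: le_lt_trans xz|exact: le_lt_trans yz].
- by apply: measurable_funTS; apply/measurable_EFinP; exact: measurable_joint_density.
- exact: measurableI (measurable_quadrant _ _) measurable_upper_half.
- exact: measurableI (measurable_quadrant _ _) measurable_lower_half.
congr (_ + _)%E.
- rewrite -(@integral_triangle_fst _ (density1 B H1 H2 S i t) _ x y).
  + apply: eq_integral => z /set_mem[[xz yz] zz] /=.
    by rewrite joint_density_lower// (le_lt_trans ty).
  + exact: measurable_density1.
  + move=> a b xa yb ba; apply: density1_ge0 => //; last exact: ltW.
    exact: le_trans ty (ltW yb).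
  + move=> b yb; apply: integral_density1_inner => //.
      exact: le_trans ty (ltW yb).
    by rewrite le_max lexx orbT.
- rewrite -(@integral_triangle_snd _ (density1 B H2 H1 S i t) _ x y).
  + apply: eq_integral => z /set_mem[[xz yz] zz] /=.
    by rewrite joint_density_upper// (le_lt_trans tx).
  + exact: (measurable_density2 H1 H2).
  + move=> a b ya xb ba; apply: density1_ge0 => //; last exact: ltW.
    exact: le_trans tx (ltW xb).
  + move=> b xb; apply: integral_density1_inner => //.
      exact: le_trans tx (ltW xb).
    by rewrite le_max lexx orbT.
Qed.

Let integral_diagonal x y : t <= x -> t <= y ->
  (\int[lam]_(c in [set c | (t < c)%R /\ quadrant x y (c, c)]) (f c c)%:E =
   \int[lam]_(c in `]Num.max x y, +oo[) (density0 B H1 H2 S i t c)%:E)%E.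
Proof.
move=> tx ty; rewrite (_ : [set c | _] = `]Num.max x y, +oo[%classic).
  apply: eq_integral => c /set_mem; rewrite /= in_itv/= andbT gt_max => /andP[xc _].
  by rewrite joint_density_diag// (le_lt_trans tx).
apply/seteqP; split => c /=; rewrite in_itv/= andbT gt_max.
  by move=> [_ [-> ->]].
by move=> /andP[xc yc]; split; [exact: le_lt_trans tx xc|split].
Qed.

Let survival_atom : survival t t = 1 - atom_mass H1 H2 i.
Proof.
rewrite /survival lexx /survival1 /atom_mass subKr.
rewrite maxxx subrr.
rewrite (eq_bigr (fun k => ((delta_mx ord0 i : 'rV_n) *m S k) *m (H2 *m (H1 *m one)))).
  by rewrite -mulmx_suml v1 !mulmxA.
by move=> k _; rewrite !expmx0 !mulmx1 !mulmxA.
Qed.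

Lemma joint_law_exists : exists nu : probability plane R,
  [/\ has_joint_density t f nu, nu (~` survival_support t) = 0%E &
      forall x y, t <= x -> t <= y -> nu (quadrant x y) = (survival x y)%:E].
Proof.
have fpos z : off_diagonal z -> 0 <= f z.1 z.2.
  by move=> [tx ty _]; apply: joint_density_ge0; left.
have [nu1 nu1E] := @density_measure _ plane R (lam \x lam)%E off_diagonal
  (fun z => f z.1 z.2) measurable_off_diagonal
  (measurable_funTS (measurable_joint_density H1 H2)) fpos.
have dpos (x : measurableTypeR R) : `]t, +oo[%classic x ->
    0 <= density0 B H1 H2 S i t x.
  by rewrite /= in_itv/= andbT => tx; apply: density0_ge0 => //; exact: ltW.
have [nu0 nu0E] := @density_measure _ (measurableTypeR R) R lam `]t, +oo[%classic
  (density0 B H1 H2 S i t) (measurable_itv _)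
  (measurable_funTS (measurable_density0 H1 H2)) dpos.
(* The singular part is the image under the diagonal embedding of a measure on the line. *)
pose diag (x : measurableTypeR R) : plane := (x, x).
have mdiag : measurable_fun setT diag by exact: measurable_fun_pair.
pose nu2 := [the {measure set plane -> \bar R} of pushforward nu0 diag].
pose nu3 : {measure set plane -> \bar R} :=
  mscale (NngNum atom_mass_ge0) (dirac ((t, t) : plane)).
pose M := measure_add nu1 (measure_add (nu2 mdiag) nu3).
have ME A : M A = (\int[(lam \x lam)]_(z in A `&` off_diagonal) (f z.1 z.2)%:E
    + \int[lam]_(x in [set x | (t < x)%R /\ A (x, x)]) (f x x)%:E
    + (f t t)%:E * \d_((t, t)) A)%E.
  rewrite /M measure_addE nu1E -addeA; congr (_ + _)%E.
  apply: (etrans (measure_addE (nu2 mdiag) nu3 A)).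
  rewrite [X in (_ + X)%E](_ : _ = ((f t t)%:E * \d_((t, t)) A)%E); last first.
    by rewrite /nu3/= /mscale/= joint_density_atom.
  congr (_ + _)%E.
  rewrite /nu2 /= /pushforward nu0E.
  rewrite [in RHS](_ : [set x | _] = diag @^-1` A `&` `]t, +oo[).
    apply: eq_integral => x /set_mem[_] /=; rewrite in_itv/= andbT => tx.
    by rewrite joint_density_diag.
  by apply/seteqP; split => x /=; rewrite in_itv/= andbT => -[].
have MQ x y : t <= x -> t <= y -> M (quadrant x y) = (survival x y)%:E.
  move=> tx ty; rewrite ME integral_off_diagonal// integral_diagonal//.
  rewrite quadrant_mass// diracE memNset ?mule0 ?adde0//.
  by move=> [/= xt _]; move: (le_lt_trans tx xt); rewrite ltxx.
(* All mass off the open quadrant at (t, t) is the atom, and [survival_atom] makes the two add up to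
   1; the weights having sum 1 enters there. *)
have M1 : M setT = 1%E.
  transitivity (M (quadrant t t) + (f t t)%:E)%E; last first.
    by rewrite MQ// survival_atom joint_density_atom -EFinD subrK.
  rewrite !ME (_ : setT `&` _ = quadrant t t `&` off_diagonal); last first.
    by rewrite setTI; apply/esym/setIidr => z [].
  rewrite (_ : [set x | _ /\ setT _] = [set x | t < x /\ quadrant t t (x, x)]); last first.
    by apply/seteqP; split => x /= [tx _].
  rewrite !diracE mem_setT memNset ?mule1 ?mule0 ?adde0//.
  by move=> [/=]; rewrite ltxx.
have [nu nuE] := probability_of_measure M1.
exists nu; split.
- split; first exact: measurable_joint_density.
    exact: joint_density_ge0.
  by move=> A _; exact: (etrans (nuE A) (ME A)).
- apply: (etrans (nuE _) _); apply: (etrans (ME _) _); rewrite (_ : _ `&` off_diagonal = set0) ?integral_set0; last first.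
    by apply/seteqP; split => z // [/= nz [tx ty _]]; apply: nz; right.
  rewrite (_ : [set x | _] = set0) ?integral_set0; last first.
    by apply/seteqP; split => x // [/= tx nz]; apply: nz; right.
  by rewrite diracE memNset ?mule0 ?adde0// => nz; apply: nz; left.
- by move=> x y tx ty; exact: (etrans (nuE _) (MQ _ _ tx ty)).
Qed.

End joint_law_existence.

(** * Intensity matrices and closed sets *)

Section intensity.
Context {R : realType} {n : nat}.
Implicit Types (B : 'M[R]_n) (Gam : {set 'I_(n + 1)}).

Lemma is_subintensity_intensity B :
  is_intensity (intensity_of B) -> B \in unitmx -> is_subintensity B.
Proof.
move=> [Q0 _] uB; split => // [i j ij|i j].
  have := Q0 (transient i) (transient j); rewrite /intensity_of block_mxEul.
  by apply; apply: contra ij => /eqP/lshift_inj ->.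
have := Q0 (transient i) (absorbing n); rewrite /intensity_of block_mxEur.
by rewrite (ord1 j); apply; rewrite eq_lrshift.
Qed.

Lemma transient_or_absorbing (x : 'I_(n + 1)) :
  x = absorbing n \/ exists i, x = transient i.
Proof.
case: (split_ordP x) => j ->; first by right; exists j.
by left; rewrite (ord1 j).
Qed.

(** The row of Delta is zero, so a path of transitions through Delta contributes nothing; the last
    factor is peeled off to exploit this. *)
Lemma intensity_pow B k i j :
  ((intensity_of B) ^+ k) (transient i) (transient j) = (B ^+ k) i j.
Proof.
elim: k i j => [|k IHk] i j; first by rewrite !expr0 !mxE eq_lshift.
rewrite !exprSr !mxE big_split_ord/= big_ord1.
rewrite [intensity_of B (rshift _ _) _]block_mxEdl mxE mulr0 addr0.
by apply: eq_bigr => l _; rewrite IHk block_mxEul.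
Qed.

Lemma expmx_intensity B u i j :
  expmx (u *: intensity_of B) (transient i) (transient j) = expmx (u *: B) i j.
Proof.
rewrite !expmxE; congr (limn (pseries _ _)); apply/funext => k.
by rewrite /expcoef intensity_pow.
Qed.

Lemma expmx_closed (Q : 'M[R]_(n + 1)) Gam u x y :
  (forall a b, a \in Gam -> b \notin Gam -> Q a b = 0) ->
  x \in Gam -> y \notin Gam -> expmx (u *: Q) x y = 0.
Proof.
move=> Q0 xG yG; rewrite expmxE; apply/cvg_lim => //.
have pow0 k : (Q ^+ k) x y = 0.
  elim: k x xG => [|k IHk] x xG.
    by rewrite expr0 mxE; case: eqP yG xG => // -> /negP.
  rewrite exprS mxE big1// => l _; have [lG|lG] := boolP (l \in Gam).
    by rewrite IHk// mulr0.
  by rewrite Q0// mul0r.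
rewrite (_ : pseries _ _ = fun=> 0); first exact: cvg_cst.
apply/funext => N; rewrite /pseries /series /= big1// => k _.
by rewrite /expcoef addn0 pow0 mulr0 mul0r.
Qed.

Lemma outside_mx_mull Gam p (M : 'M[R]_(n, p)) i j :
  (outside_mx R Gam *m M) i j = (transient i \notin Gam)%:R * M i j.
Proof. by rewrite mul_diag_mx !mxE. Qed.

Lemma outside_mx_mulr Gam p (M : 'M[R]_(p, n)) i j :
  (M *m outside_mx R Gam) i j = M i j * (transient j \notin Gam)%:R.
Proof. by rewrite mul_mx_diag !mxE. Qed.

Lemma outside_mx_compl Gam i j :
  (1%:M - outside_mx R Gam) i j = (transient i \in Gam)%:R * (i == j)%:R.
Proof.
rewrite !mxE; case: eqVneq => [->|_]; last by rewrite !mulr0n mulr0 subrr.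
by rewrite !mulr1n mulr1; case: (_ \in _); rewrite ?subr0 ?subrr.
Qed.

Lemma is_exit_outside m (B : 'I_m -> 'M[R]_n) Gam :
  (forall k, is_subintensity (B k)) ->
  stochastically_closed (fun k => intensity_of (B k)) Gam ->
  is_exit B (outside_mx R Gam).
Proof.
move=> HB GC.
have B0 k i j : transient i \in Gam -> transient j \notin Gam -> B k i j = 0.
  by move=> iG jG; have := GC k _ _ iG jG; rewrite block_mxEul.
split.
- by move=> i j; rewrite mxE; case: eqP; rewrite ?mulr1n ?mxE ?mulr0n.
- by move=> i j; rewrite outside_mx_compl mulr_ge0.
- move=> k; apply/matrixP => i j; rewrite !outside_mx_mulr outside_mx_mull.
  have [iG|iG] := boolP (transient i \in Gam); last by rewrite mul1r.
  have [jG|jG] := boolP (transient j \in Gam); first by rewrite !mulr0.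
  by rewrite B0// mulr0 mul0r.
- move=> k i j; rewrite mulmxBr mulmx1 mxE [X in _ + X]mxE outside_mx_mulr.
  rewrite -[X in X - _]mulr1 -mulrBr outside_mx_mull.
  have [jG|jG] := boolP (transient j \in Gam); last by rewrite subrr mulr0.
  have [iG|iG] := boolP (transient i \in Gam); first by rewrite !mul0r.
  rewrite mul1r subr0 mulr1; apply: sub_off (HB k) _ _ _.
  by apply: contra iG => /eqP ->.
Qed.

Lemma outside_mx_disjoint Gam1 Gam2 : Gam1 :&: Gam2 = [set absorbing n]%SET ->
  (1%:M - outside_mx R Gam1) *m (1%:M - outside_mx R Gam2) = 0.
Proof.
move=> G12; apply/matrixP => i j; rewrite !mxE big1// => l _.
rewrite !outside_mx_compl; case: (eqVneq i l) => [<-|_]; last by rewrite !mulr0 mul0r.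
case: (boolP (transient i \in Gam1)) => [i1|_]; last by rewrite !mul0r.
case: (boolP (transient i \in Gam2)) => [i2|_]; last by rewrite mul0r mulr0.
have : transient i \in Gam1 :&: Gam2 by rewrite inE i1.
by rewrite G12 inE /transient /absorbing eq_lrshift.
Qed.

(* P{X_y avoids Gam2, X_x avoids Gam1 | X_t = i} for t <= y <= x under the
   intensity matrix of B. *)
Definition exit_prob B Gam1 Gam2 i t x y : R :=
  \sum_(a | a \notin Gam2) \sum_(b | b \notin Gam1)
    expmx ((y - t) *: intensity_of B) (transient i) a *
    expmx ((x - y) *: intensity_of B) a b.

Definition joint_exit_prob B Gam1 Gam2 i t x y : R :=
  if y <= x then exit_prob B Gam1 Gam2 i t x y else exit_prob B Gam2 Gam1 i t y x.

Lemma sum_outside Gam (F : 'I_(n + 1) -> R) : absorbing n \in Gam ->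
  \sum_(a | a \notin Gam) F a =
  \sum_a (transient a \notin Gam)%:R * F (transient a).
Proof.
move=> aG; rewrite big_mkcond big_split_ord/= big_ord1 aG addr0.
by apply: eq_bigr => a _; case: (_ \in _); rewrite ?mul0r ?mul1r.
Qed.

Lemma exit_probE B Gam1 Gam2 i t x y :
  absorbing n \in Gam1 -> absorbing n \in Gam2 ->
  exit_prob B Gam1 Gam2 i t x y = ((delta_mx ord0 i : 'rV_n) *m
    expmx ((y - t) *: B) *m outside_mx R Gam2 *m expmx ((x - y) *: B)
    *m (outside_mx R Gam1 *m (const_mx 1 : 'cV_n))) 0 0.
Proof.
move=> a1 a2; rewrite /exit_prob sum_outside//.
under eq_bigr do rewrite sum_outside//.
rewrite -(mulmxA _ (expmx ((x - y) *: B))) mxE.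
rewrite [RHS](eq_bigr (fun a => \sum_b (transient a \notin Gam2)%:R *
  ((transient b \notin Gam1)%:R * (expmx ((y - t) *: B) i a * expmx ((x - y) *: B) a b)))).
  apply: eq_bigr => a _; rewrite mulr_sumr; apply: eq_bigr => b _.
  by rewrite !expmx_intensity.
move=> a _; rewrite outside_mx_mulr -rowE !mxE mulr_sumr; apply: eq_bigr => b _.
by rewrite outside_mx_mull !mxE; ring.
Qed.

Lemma survival_exit_prob m (B : 'I_m -> 'M[R]_n) Gam1 Gam2 (s : 'I_m -> 'I_n -> R) i t x y :
  absorbing n \in Gam1 -> absorbing n \in Gam2 ->
  survival B (fun k => diag_mx (\row_j s k j)) i t (outside_mx R Gam1) (outside_mx R Gam2) x y =
  \sum_k s k i * joint_exit_prob (B k) Gam1 Gam2 i t x y.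
Proof.
move=> a1 a2.
have E (k : 'I_m) : (delta_mx ord0 i : 'rV_n) *m diag_mx (\row_j s k j) =
    s k i *: (delta_mx ord0 i : 'rV[R]_n).
  apply/rowP => j; rewrite mul_mx_diag !mxE eqxx/=.
  by case: eqP => [->|_]; rewrite ?mulr1 ?mul1r// mulr0 mul0r.
have H (G1 G2 : {set 'I_(n + 1)}) (u v : R) : absorbing n \in G1 -> absorbing n \in G2 -> v <= u ->
    survival1 B (outside_mx R G1) (outside_mx R G2) (fun k => diag_mx (\row_j s k j)) i t u v =
    \sum_k s k i * exit_prob (B k) G1 G2 i t u v.
  move=> g1 g2 vu; rewrite /survival1 summxE; apply: eq_bigr => k _.
  by rewrite exit_probE// E max_l// -!scalemxAl mxE.
by rewrite /survival /joint_exit_prob; case: leP => [yx|/ltW xy]; rewrite H.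
Qed.

End intensity.

(** * The mixture process *)

Lemma measurable_fiber d (T : measurableType d) N (f : T -> 'I_N) (p : pred 'I_N) :
  (forall x, measurable [set w | f w = x]) -> measurable [set w | p (f w)].
Proof.
move=> mf; rewrite (_ : [set _ | _] = \big[setU/set0]_(x | p x) [set w | f w = x]).
  exact: bigsetU_measurable.
rewrite -bigcup_seq_cond; apply/seteqP; split => w /=.
  by move=> pw; exists (f w) => //=; rewrite mem_index_enum.
by move=> [x /= /andP[_ px]] ->.
Qed.

Section finite_partition.
Context {d : measure_display} {T : measurableType d} {R : realType}.
Variable P : probability T R.

Definition pr (A : set T) : R := fine (P A).

Lemma prE A : measurable A -> P A = (pr A)%:E.
Proof. by move=> mA; rewrite /pr fineK// fin_num_measure. Qed.

Lemma le_pr A C : measurable A -> measurable C -> A `<=` C -> pr A <= pr C.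
Proof. by move=> mA mC AC; rewrite -lee_fin -!prE// le_measure ?inE. Qed.

Lemma pr_ge0 A : 0 <= pr A.
Proof. by rewrite /pr fine_ge0. Qed.

Lemma pr0P A : measurable A -> P A = 0%E <-> pr A = 0.
Proof. by move=> mA; rewrite prE//; split => [[]|->]. Qed.

Lemma pr_sub0 A C : measurable A -> measurable C -> A `<=` C -> pr C = 0 -> pr A = 0.
Proof. by move=> mA mC AC C0; apply/eqP; rewrite eq_le pr_ge0 -C0 le_pr. Qed.

Lemma pr_partition N (f : T -> 'I_N) (Q : pred 'I_N) A :
  (forall x, measurable [set w | f w = x]) -> measurable A ->
  pr (A `&` [set w | Q (f w)]) = \sum_(x | Q x) pr (A `&` [set w | f w = x]).
Proof.
move=> mf mA; have mAf x : measurable (A `&` [set w | f w = x]) by exact: measurableI.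
have E : A `&` [set w | Q (f w)] =
    \big[setU/set0]_(x < N | Q x) (A `&` [set w | f w = x]).
  rewrite -bigcup_seq_cond; apply/seteqP; split => w /=.
    by move=> [Aw Qw]; exists (f w) => //=; rewrite mem_index_enum.
  by move=> [x /= /andP[_ Qx] [Aw fw]]; split => //; rewrite fw.
apply: EFin_inj; rewrite -sumEFin -prE; last by rewrite E; exact: bigsetU_measurable.
rewrite E measure_bigsetU_ord//; last first.
  by move=> x y _ _ [w [[_ <-] [_ <-]]].
by apply: eq_bigr => x _; exact: (prE (mAf x)).
Qed.

End finite_partition.

(** * The Markov property within a regime *)

Section markov_mixture.
Context {d : measure_display} {T : measurableType d} {R : realType}.
Context {P : probability T R} {m n : nat}.
Variables (B : 'I_m -> 'M[R]_n) (pi0 : 'I_n -> R) (s0 : 'I_m -> 'I_n -> R).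
Variables (phi : T -> 'I_m) (X : R -> T -> 'I_(n + 1)).
Hypothesis hX : is_mixture_process P B pi0 s0 phi X.

Let Q k := intensity_of (B k).
Let E k u : 'M[R]_(n + 1) := expmx (u *: Q k).
Let regime k : set T := [set w | phi w = k].
Let at_time t x : set T := [set w | X t w = x].

Let mregime k : measurable (regime k). Proof. exact: mix_phi_measurable hX k. Qed.

Let mat_time t x : 0 <= t -> measurable (at_time t x).
Proof. exact: mix_X_measurable hX t x. Qed.

Lemma history_cons t x (h : seq (R * 'I_(n + 1))) :
  history X ((t, x) :: h) = history X h `&` at_time t x.
Proof.
apply/seteqP; split => w /=.
  move=> H; split; last by apply: (H (t, x)); rewrite mem_head.
  by move=> e eh; apply: H; rewrite inE eh orbT.
by move=> [H Xt] e; rewrite inE => /predU1P[->//|]; exact: H.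
Qed.

Lemma history_nil : history X [::] = setT.
Proof. by apply/seteqP; split. Qed.

Lemma history_cat (h h' : seq (R * 'I_(n + 1))) :
  history X (h ++ h') = history X h `&` history X h'.
Proof.
elim: h => [|[t x] h IHh]; first by rewrite history_nil setTI.
by rewrite cat_cons !history_cons IHh setIAC.
Qed.

Lemma measurable_history (h : seq (R * 'I_(n + 1))) :
  (forall e, e \in h -> 0 <= e.1) -> measurable (history X h).
Proof.
elim: h => [|[t x] h IHh] H; first by rewrite history_nil.
rewrite history_cons; apply: measurableI.
  by apply: IHh => e eh; apply: H; rewrite inE eh orbT.
by apply: mat_time; apply: (H (t, x)); rewrite mem_head.
Qed.

(** A product form of the Markov property that also covers null histories, where both sides vanish.
    The assumption conditions on the regime and on X_0, so the initial state is summed out; starting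
    in Delta has probability 0. *)
Lemma markov_step k (h : seq (R * 'I_(n + 1))) t u x y :
  (forall e, e \in h -> 0 <= e.1 <= t) -> 0 <= t -> 0 <= u ->
  pr P (regime k `&` history X ((t, x) :: h) `&` at_time (t + u) y) =
  pr P (regime k `&` history X ((t, x) :: h)) * E k u x y.
Proof.
move=> ht t0 u0; set W := history X _.
have mW : measurable W.
  apply: measurable_history => e; rewrite inE => /predU1P[->//|eh].
  by have /andP[] := ht e eh.
have mY : measurable (at_time (t + u) y) by apply: mat_time; exact: addr_ge0.
have split0 A : measurable A -> pr P A = \sum_x0 pr P (A `&` at_time 0 x0).
  move=> mA; rewrite -(pr_partition P xpredT _ mA) => [|z]; last exact: mat_time.
  by congr (pr P _); apply/seteqP; split => w // [].
rewrite split0; last by do 2?apply: measurableI.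
rewrite [in RHS]split0; last exact: measurableI.
rewrite mulr_suml; apply: eq_bigr => x0 _.
have mC : measurable (regime k `&` at_time 0 x0).
  by apply: measurableI => //; exact: mat_time.
set C := _ `&` _ in mC.
rewrite [X in pr P X = _](_ : _ = at_time (t + u) y `&` (C `&` W)); last first.
  by apply/seteqP; split => w [] => [[[? ?] ?] ?|? [[? ?] ?]]; do ![split].
rewrite [X in pr P X * _](_ : _ = C `&` W); last first.
  by apply/seteqP; split => w [] => [[? ?] ?|[? ?] ?]; do ![split].
have mCW : measurable (C `&` W) by exact: measurableI.
have [CW0|CW0] := eqVneq (pr P (C `&` W)) 0.
  rewrite CW0 mul0r; apply: pr_sub0 CW0 => //; first exact: measurableI.
have C0 : P C != 0%E.
  apply: contra CW0 => /eqP/pr0P C0; apply/eqP.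
  by apply: pr_sub0 (C0 mC) => //.
have [x0E|[i0 x0E]] := transient_or_absorbing x0.
  case/eqP: C0; apply: (subset_measure0 _ (mat_time (absorbing n) (lexx 0))) => //.
    by rewrite /C x0E.
  exact: mix_init_absorbing hX.
have [_ markov] : markov_jump P C X (Q k) (transient i0).
  by rewrite /C x0E; apply: mix_markov hX _ _ _; rewrite /C x0E in C0.
have := markov h t u x y ht t0 u0; rewrite -[_ `&` [set w | X t w = x]]history_cons.
move=> /(_ ltac:(by rewrite prE//; apply: contra CW0 => /eqP[->])).
rewrite /cprob -/(pr P _) -/(pr P _) => <-.
by rewrite mulrC divfK.
Qed.

Lemma mixture_exp_ge0 k u : 0 <= u -> mx_ge0 (E k u).
Proof. by apply: expmx_ge0 => i j; apply: (mix_intensity hX k).1. Qed.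

Lemma markov_two_steps k (h : seq (R * 'I_(n + 1))) t x y z a b :
  (forall e, e \in h -> 0 <= e.1 <= t) -> 0 <= t -> t <= y -> y <= x ->
  pr P (history X h `&` (regime k `&` at_time t z `&` at_time y a `&` at_time x b)) =
  pr P (history X h `&` (regime k `&` at_time t z)) * (E k (y - t) z a * E k (x - y) a b).
Proof.
move=> ht t0 ty yx.
have h1 : forall e, e \in (t, z) :: h -> 0 <= e.1 <= y.
  move=> e; rewrite inE => /predU1P[->/=|/ht/andP[-> et]]; first by rewrite t0.
  exact: le_trans et ty.
have S1 := markov_step k z a ht t0 (_ : 0 <= y - t).
have S2 := markov_step k a b h1 (le_trans t0 ty) (_ : 0 <= x - y).
move: S1 S2; rewrite !subr_ge0 => /(_ ty) S1 /(_ yx).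
rewrite [y + _]addrC subrK history_cons setIA => S2.
move: S1; rewrite [t + _]addrC subrK => S1; rewrite {}S1 history_cons in S2.
rewrite mulrA (_ : history X h `&` (regime k `&` at_time t z) =
  regime k `&` (history X h `&` at_time t z)) -?S2; last by rewrite setICA.
by congr (pr P _); apply/seteqP; split => w [] => [? [[[? ?] ?] ?]|[[? [? ?]] ?] ?]; do ![split].
Qed.

Lemma markov_past k t x y z a b (C : set T) : strict_past X t C ->
  0 <= t -> t <= y -> y <= x ->
  pr P (C `&` (regime k `&` at_time t z `&` at_time y a `&` at_time x b)) =
  pr P (C `&` (regime k `&` at_time t z)) * (E k (y - t) z a * E k (x - y) a b).
Proof.
move=> CX t0 ty yx.
have y0 := le_trans t0 ty; have x0 := le_trans y0 yx.
have mD : measurable (regime k `&` at_time t z).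
  by apply: measurableI => //; exact: mat_time.
have mA : measurable (regime k `&` at_time t z `&` at_time y a `&` at_time x b).
  by do 2 (apply: measurableI; last exact: mat_time).
pose past := [set A | exists2 h : seq (R * 'I_(n + 1)),
  (forall e, e \in h -> 0 <= e.1 < t) & A = history X h].
have mpast : past `<=` measurable.
  by move=> _ [h ht ->]; apply: measurable_history => e /ht/andP[].
have pastC : (<<s past >>) C.
  apply: smallest_sub CX; first exact: smallest_sigma_algebra.
  move=> _ [s [c [/andP[s0' st] ->]]]; apply: sub_sigma_algebra.
  exists [:: (s, c)]; last by rewrite history_cons history_nil setTI.
  by move=> e; rewrite inE => /eqP ->; rewrite s0'.
have mC : measurable C.
  by apply: smallest_sub pastC; [exact: sigma_algebra_measurable|].
have c0 : 0 <= E k (y - t) z a * E k (x - y) a b.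
  by rewrite mulr_ge0//; apply: mixture_exp_ge0; rewrite subr_ge0.
(* The two sides are read as finite measures in [C]. They agree on [past], which is stable under
   intersection because histories concatenate. *)
pose m1 : {measure set T -> \bar R} := mrestr P mA.
pose m2 : {measure set T -> \bar R} := mscale (NngNum c0) (mrestr P mD).
have m1E F : measurable F -> m1 F = (pr P (F `&`
    (regime k `&` at_time t z `&` at_time y a `&` at_time x b)))%:E.
  by move=> mF; exact: (prE P (measurableI _ _ mF mA)).
have m2E F : measurable F -> m2 F = (E k (y - t) z a * E k (x - y) a b *
    pr P (F `&` (regime k `&` at_time t z)))%:E.
  move=> mF; rewrite EFinM -(prE P (measurableI _ _ mF mD)).
  by [].
have : m1 C = m2 C.
  apply: (@g_sigma_algebra_measure_unique _ _ _ past mpast (fun=> setT)) => //.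
  - by move=> _; exists [::]; rewrite ?history_nil.
  - by rewrite bigcup_const//; exists 0%N.
  - move=> _ _ [h ht ->] [h' ht' ->]; exists (h ++ h'); last by rewrite history_cat.
    by move=> e; rewrite mem_cat => /orP[/ht|/ht'].
  - move=> _ [h ht ->].
    have mh : measurable (history X h) by apply: mpast; exists h.
    rewrite m1E// m2E// (markov_two_steps k z a b _ t0 ty yx) 1?mulrC//.
    by move=> e /ht/andP[-> /ltW ->].
  - by move=> _; rewrite m1E// ltry.
by rewrite m1E// m2E// => -[->]; rewrite mulrC.
Qed.

Lemma stay_closed (Gam : {set 'I_(n + 1)}) u v :
  stochastically_closed Q Gam -> 0 <= u -> u <= v ->
  P ([set w | X u w \in Gam] `&` [set w | X v w \notin Gam]) = 0%E.
Proof.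
move=> GC u0 uv; have v0 := le_trans u0 uv.
have mu : measurable [set w | X u w \in Gam].
  by apply: (measurable_fiber (fun x => x \in Gam)) => x; exact: mat_time.
have mv : measurable [set w | X v w \notin Gam].
  by apply: (measurable_fiber (fun x => x \notin Gam)) => x; exact: mat_time.
apply/(pr0P P (measurableI _ _ mu mv)).
rewrite (pr_partition P (fun x => x \notin Gam) (fun x => mat_time x v0) mu).
apply: big1 => y yG; rewrite setIC.
rewrite (pr_partition P (fun x => x \in Gam) (fun x => mat_time x u0) (mat_time y v0)).
apply: big1 => x xG.
have mxy : measurable (at_time v y `&` at_time u x) by apply: measurableI; exact: mat_time.
rewrite (_ : _ `&` _ = (at_time v y `&` at_time u x) `&` [set w | xpredT (phi w)]); last first.
  by apply/seteqP; split => w // [].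
rewrite (pr_partition P xpredT mregime mxy); apply: big1 => k _.
have := @markov_step k [::] u (v - u) x y _ u0; rewrite subr_ge0 => /(_ _ uv).
rewrite [u + _]addrC subrK history_cons history_nil setTI.
rewrite /E (expmx_closed _ (GC k))// mulr0 => <-//.
by congr (pr P _); apply/seteqP; split => w [] [? ?] ?; do ![split].
Qed.

End markov_mixture.

Lemma pr_setD_null d (T : measurableType d) (R : realType) (P : probability T R)
    (A C N : set T) : measurable A -> measurable C -> measurable N -> P N = 0%E ->
  pr P (C `&` (A `\` N)) = pr P (C `&` A).
Proof.
move=> mA mC mN N0; congr fine.
rewrite [RHS](measureDI P (measurableI _ _ mC mA) mN).
rewrite [X in (_ + X)%E](_ : _ = 0%E) ?adde0 ?setIDA//.
apply: subset_measure0 N0; [|by []|exact: subIsetr].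
by apply: measurableI => //; exact: measurableI.
Qed.

(** Right continuity is used twice: a visit before [u] lasts until some rational time still before
    [u], and a path outside the set at [u] stays outside for a while, which makes the inequality
    strict. *)
Lemma hitting_time_gtP d (T : measurableType d) (R : realType) N (X : R -> T -> 'I_N)
    (Gam : {set 'I_N}) (u : R) (w : T) : path_right_continuous X -> 0 <= u ->
  (u%:E < hitting_time X Gam w)%E <->
  X u w \notin Gam /\ forall q : rat, 0 <= (ratr q : R) < u -> X (ratr q) w \notin Gam.
Proof.
move=> rc u0.
have right s : 0 <= s -> exists2 e, 0 < e & forall v, s < v -> v < s + e -> X v w = X s w.
  move=> s0; have [e /= e0 H] := rc w s s0; exists e => // v sv vs.
  apply: H => //=; rewrite /ball_ /= distrC gtr0_norm ?subr_gt0//.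
  by rewrite ltrBlDl.
split=> [uh|[uG qG]].
  have H s : 0 <= s -> s <= u -> X s w \notin Gam.
    move=> s0 su; apply/negP => sG; move: uh; apply/negP; rewrite -leNgt.
    apply: (@le_trans _ _ s%:E); last by rewrite lee_fin.
    by apply: ereal_inf_lbound; exists s.
  by split=> [|q /andP[q0 qu]]; apply: H => //; exact: ltW.
have H s : 0 <= s -> s <= u -> X s w \notin Gam.
  move=> s0; rewrite le_eqVlt => /predU1P[->//|su].
  have [e e0 He] := right s s0.
  have : s < Num.min (s + e) u by rewrite lt_min su ltrDl e0.
  move=> /rat_in_itvoo[q]; rewrite in_itv/= lt_min => /and3P[sq qe qu].
  by rewrite -(He _ sq qe); apply: qG; rewrite qu (le_trans s0)// ltW.
have [e e0 He] := right u u0.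
apply: (@lt_le_trans _ _ (u + e)%:E); first by rewrite lte_fin ltrDl.
apply: le_ereal_inf_tmp => _ [s [s0 sG] <-]; rewrite lee_fin leNgt.
apply/negP => se; have [su|us] := leP s u; first by move: (H _ s0 su); rewrite sG.
by move: uG; rewrite -(He _ us se) sG.
Qed.

(** * Hitting times of closed sets given the past *)

Section hitting_times.
Context {d : measure_display} {T : measurableType d} {R : realType}.
Context {P : probability T R} {m n : nat}.
Variables (B : 'I_m -> 'M[R]_n) (pi0 : 'I_n -> R) (s0 : 'I_m -> 'I_n -> R).
Variables (phi : T -> 'I_m) (X : R -> T -> 'I_(n + 1)).
Hypothesis hX : is_mixture_process P B pi0 s0 phi X.

Let avoids (Gam : {set 'I_(n + 1)}) u : set T := [set w | X u w \notin Gam].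
Let regime k : set T := [set w | phi w = k].
Let at_time t x : set T := [set w | X t w = x].

Let mregime k : measurable (regime k). Proof. exact: mix_phi_measurable hX k. Qed.

Let mat_time t x : 0 <= t -> measurable (at_time t x).
Proof. exact: mix_X_measurable hX t x. Qed.

Let mavoids Gam u : 0 <= u -> measurable (avoids Gam u).
Proof.
by move=> u0; apply: (measurable_fiber (fun x => x \notin Gam)) => x; exact: mat_time.
Qed.

(* By right continuity the path meets [Gam] before [u] iff it does so at a
   rational time or at [u]; leaving [Gam] is a null event. *)
Lemma hitting_time_gt_ae Gam u : stochastically_closed (fun k => intensity_of (B k)) Gam ->
  0 <= u -> exists N, [/\ measurable N, P N = 0%E &
    [set w | (u%:E < hitting_time X Gam w)%E] = avoids Gam u `\` N].
Proof.
move=> GC u0.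
pose F (q : rat) := if 0 <= (ratr q : R) < u then
  [set w | X (ratr q) w \in Gam] `&` avoids Gam u else set0.
have mF q : measurable (F q).
  rewrite /F; case: ifPn => // /andP[q0 _]; apply: measurableI; last exact: mavoids.
  by apply: (measurable_fiber (fun x => x \in Gam)) => x; exact: mat_time.
have F0 q : P (F q) = 0%E.
  rewrite /F; case: ifPn => [/andP[q0 qu]|_]; last exact: measure0.
  by apply: (stay_closed hX GC) => //; exact: ltW.
pose N := \bigcup_k (if unpickle k is Some q then F q else set0).
have mN : measurable N by apply: bigcupT_measurable => k; case: unpickle.
exists N; split => //.
  apply: measure_negligible => //; apply: negligible_bigcup => k.
  by apply/negligibleP; case: unpickle => // q; exact: F0.
apply/seteqP; split => w /=.
  move=> /(hitting_time_gtP _ _ (mix_right_continuous hX) u0)[uG qG].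
  split => // -[k _]; case: unpickle => // q; rewrite /F; case: ifPn => // qu [/= qiG _].
  by move: (qG q qu); rewrite qiG.
move=> [uG nN]; apply/(hitting_time_gtP _ _ (mix_right_continuous hX) u0).
split; first exact: uG.
move=> q qu; apply/negP => qG; apply: nN; exists (pickle q); first by [].
by rewrite pickleK /F qu; split.
Qed.

Lemma avoids_past k Gam1 Gam2 t x y i C : strict_past X t C -> measurable C ->
  0 <= t -> t <= y -> y <= x ->
  pr P (C `&` (regime k `&` at_time t (transient i)) `&` avoids Gam2 y `&` avoids Gam1 x) =
  pr P (C `&` (regime k `&` at_time t (transient i))) * exit_prob (B k) Gam1 Gam2 i t x y.
Proof.
move=> CX mC t0 ty yx; have y0 := le_trans t0 ty; have x0 := le_trans y0 yx.
have mD : measurable (C `&` (regime k `&` at_time t (transient i))).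
  by do ?apply: measurableI => //; exact: mat_time.
set D := C `&` _ in mD *; rewrite setIAC (pr_partition P (f := X y) (fun a => a \notin Gam2)); last 2 first.
- by move=> a; exact: mat_time.
- by apply: measurableI => //; exact: mavoids.
rewrite /exit_prob mulr_sumr; apply: eq_bigr => a _.
rewrite setIAC (pr_partition P (f := X x) (fun b => b \notin Gam1)); last 2 first.
- by move=> b; exact: mat_time.
- by apply: measurableI => //; exact: mat_time.
rewrite mulr_sumr; apply: eq_bigr => b _.
by rewrite -(markov_past hX)// /D !setIA.
Qed.

(** The coefficients do not depend on [C]; this is the form that [condprob_lin] converts into a
    conditional probability given any information contained in the strict past. *)
Lemma survival_past Gam1 Gam2 t x y i C :
  stochastically_closed (fun k => intensity_of (B k)) Gam1 ->
  stochastically_closed (fun k => intensity_of (B k)) Gam2 ->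
  strict_past X t C -> measurable C -> 0 <= t -> t <= x -> t <= y ->
  P ([set w | (x%:E < hitting_time X Gam1 w)%E /\ (y%:E < hitting_time X Gam2 w)%E]
     `&` [set w | X t w = transient i] `&` C) =
  (\sum_k joint_exit_prob (B k) Gam1 Gam2 i t x y *
     pr P ([set w | phi w = k] `&` [set w | X t w = transient i] `&` C))%:E.
Proof.
move=> GC1 GC2 CX mC t0 tx ty; have y0 := le_trans t0 ty; have x0 := le_trans t0 tx.
have [N1 [mN1 N10 E1]] := hitting_time_gt_ae GC1 x0.
have [N2 [mN2 N20 E2]] := hitting_time_gt_ae GC2 y0.
pose A := avoids Gam1 x `&` avoids Gam2 y.
have mA : measurable A by apply: measurableI; exact: mavoids.
have mi : measurable (at_time t (transient i)) by exact: mat_time.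
have mN : measurable (N1 `|` N2) by exact: measurableU.
have N0 : P (N1 `|` N2) = 0%E.
  by apply: measure_negligible => //; apply: negligibleU; exact/negligibleP.
(* An equality of sets, not merely up to a null set: it makes the event measurable although P is not
   assumed complete. *)
have AE : [set w | (x%:E < hitting_time X Gam1 w)%E /\ (y%:E < hitting_time X Gam2 w)%E]
    = A `\` (N1 `|` N2).
  rewrite (_ : [set w | _ /\ _] = [set w | (x%:E < hitting_time X Gam1 w)%E] `&`
    [set w | (y%:E < hitting_time X Gam2 w)%E])// E1 E2 setDUr.
  apply/seteqP; split => w; rewrite /A /=; tauto.
rewrite AE -setIA setIC.
have mCi : measurable (at_time t (transient i) `&` C) by exact: measurableI.
rewrite prE; last by apply: measurableI => //; exact: measurableD.
rewrite pr_setD_null//; congr _%:E.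
rewrite (_ : _ `&` A = (at_time t (transient i) `&` C `&` A) `&` [set w | xpredT (phi w)]);
  last by apply/seteqP; split => w // [].
rewrite (pr_partition P xpredT mregime); last exact: measurableI.
apply: eq_bigr => k _; rewrite /joint_exit_prob mulrC.
rewrite (_ : [set w | phi w = k] `&` _ `&` C =
  C `&` (regime k `&` at_time t (transient i))); last by rewrite setIC.
case: leP => [yx|/ltW xy].
  rewrite -avoids_past//; congr (pr P _); rewrite /A.
  by apply/seteqP; split => w [] => [[[? ?] [? ?]] ?|[[? [? ?]] ?] ?]; do ![split].
rewrite -avoids_past//; congr (pr P _); rewrite /A.
by apply/seteqP; split => w [] => [[[? ?] [? ?]] ?|[[? [? ?]] ?] ?]; do ![split].
Qed.

End hitting_times.

(** * Conditional probabilities *)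

Lemma ae_forall_count d (T : measurableType d) (R : realType)
    (mu : {measure set T -> \bar R}) (I : countType) (Q : I -> T -> Prop) :
  (forall i, {ae mu, forall w, Q i w}) -> {ae mu, forall w, forall i, Q i w}.
Proof.
move=> HQ.
have : {ae mu, forall w, forall k, if unpickle k is Some i then Q i w else True}.
  apply: ae_foralln => k; case: unpickle => [i|]; first exact: HQ.
  exact: filterE.
by apply: filterS => w H i; have := H (pickle i); rewrite pickleK.
Qed.

Section conditional_probability.
Context {d : measure_display} {T : measurableType d} {R : realType}.
Variables (P : probability T R) (G : set (set T)).
Hypothesis hG : sigma_algebra setT G.
Hypothesis mG : G `<=` measurable.

Lemma sub_measurable_fun (Y : T -> R) :
  (forall U : set R, measurable U -> G (Y @^-1` U)) <->
  measurable_fun [set: g_sigma_algebraType G] (Y : g_sigma_algebraType G -> R).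
Proof.
split=> [GY _ U mU|mY U mU]; rewrite ?setTI.
  exact: sub_sigma_algebra (GY U mU).
have := mY measurableT U mU; rewrite setTI /measurable /=.
by rewrite (sigma_algebra_id hG).
Qed.

Lemma sub_measurable_id :
  measurable_fun [set: T] (id : T -> g_sigma_algebraType G).
Proof.
move=> _ U mU; rewrite setTI preimage_id; apply: mG.
by rewrite -(sigma_algebra_id hG).
Qed.

Definition restricted_measure : {measure set (g_sigma_algebraType G) -> \bar R}.
Proof.
refine [the {measure set (g_sigma_algebraType G) -> \bar R} of
  pushforward P (id : T -> g_sigma_algebraType G)].
exact: sub_measurable_id.
Defined.

(* The two versions are compared on the sigma-algebra [G] itself, through the
   restriction of [P] to [G]. *)
Lemma condprob_unique A Y1 Y2 : is_condprob P G A Y1 -> is_condprob P G A Y2 ->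
  {ae P, forall w, Y1 w = Y2 w}.
Proof.
move=> [GY1 iY1 EY1] [GY2 iY2 EY2].
have m1 := (sub_measurable_fun Y1).1 GY1.
have m2 := (sub_measurable_fun Y2).1 GY2.
have me1 : measurable_fun [set: g_sigma_algebraType G] (EFin \o Y1).
  exact/measurable_EFinP.
have me2 : measurable_fun [set: g_sigma_algebraType G] (EFin \o Y2).
  exact/measurable_EFinP.
have int (Y : T -> R) : measurable_fun [set: g_sigma_algebraType G] (EFin \o Y) ->
    P.-integrable setT (EFin \o Y) -> forall C, G C ->
    (\int[restricted_measure]_(w in C) (Y w)%:E = \int[P]_(w in C) (Y w)%:E)%E.
  move=> mY iY C GC; apply: (integral_pushforward sub_measurable_id mY).
    by apply: integrableS iY => //; exact: mG.
  exact: sub_sigma_algebra.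
have [N [mN N0 NE]] : ae_eq restricted_measure setT (EFin \o Y1) (EFin \o Y2).
  apply: integral_ae_eq => //.
    exact: (integrable_pushforward sub_measurable_id me1 iY1 measurableT).
  move=> C _ mC; have GC : G C by rewrite -(sigma_algebra_id hG).
  by rewrite (int _ me1 iY1 _ GC) (int _ me2 iY2 _ GC) EY1// EY2.
exists N; split => //.
  by apply: mG; rewrite -(sigma_algebra_id hG).
by move=> w /= nw; apply: NE => /= /(_ Logic.I) [].
Qed.

(** The event E where Y < 0 lies in [G], and there the integral of |Y| equals -P(A and E) <= 0. So Y
    vanishes almost everywhere on E, which makes E null. *)
Lemma condprob_ge0 A Y : is_condprob P G A Y -> {ae P, forall w, 0 <= Y w}.
Proof.
move=> [GY iY EY]; pose E := Y @^-1` `]-oo, 0[.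
have GE : G E by apply: GY; exact: measurable_itv.
have mE : measurable E by exact: mG.
have mY : measurable_fun setT (EFin \o Y) := measurable_int _ iY.
have E0 w : E w -> Y w < 0 by rewrite /E /= in_itv.
have : ae_eq P E (EFin \o Y) (cst 0%E).
  apply/(ae_eq_integral_abs P mE (measurable_funTS mY)).
  apply/eqP; rewrite eq_le; apply/andP; split; last exact: integral_ge0.
  rewrite (eq_integral (fun w => - (EFin \o Y) w)%E); last first.
    by move=> w /set_mem/E0 Yw /=; rewrite ltr0_norm.
  rewrite integralN; last first.
    by apply: integrable_add_def => //; exact: integrableS iY.
  by rewrite EY// oppe_le0 measure_ge0.
apply: filterS => w H; rewrite leNgt; apply/negP => Yw.
have := H (_ : E w); rewrite /E /= in_itv/= Yw => /(_ isT)[] Y0.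
by move: Yw; rewrite Y0 ltxx.
Qed.

Lemma condprob_lin m (A : set T) (Ak : 'I_m -> set T) (a : 'I_m -> R)
    (q : 'I_m -> T -> R) :
  (forall k, measurable (Ak k)) ->
  (forall k, is_condprob P G (Ak k) (q k)) ->
  (forall C, G C -> P (A `&` C) = (\sum_k a k * pr P (Ak k `&` C))%:E) ->
  is_condprob P G A (fun w => \sum_k a k * q k w).
Proof.
move=> mA Hq EA.
have iq k : P.-integrable setT (fun w => ((a k)%:E * (q k w)%:E)%E).
  by have [_ iq _] := Hq k; exact: integrableZl.
have sE : EFin \o (fun w => \sum_k a k * q k w) =
    (fun w => \sum_(k < m) ((a k)%:E * (q k w)%:E)%E).
  by apply/funext => w /=; rewrite -sumEFin; apply: eq_bigr => k _; rewrite EFinM.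
split.
- apply/sub_measurable_fun; apply: measurable_sum => k.
  apply: measurable_funM; first exact: measurable_cst.
  by apply/sub_measurable_fun; have [] := Hq k.
- by rewrite sE; exact: integrable_sum.
- move=> C GC; have mC := mG GC.
  rewrite -[LHS]/(integral P C (EFin \o (fun w => \sum_k a k * q k w))) sE.
  rewrite integral_sum//; last by move=> k; exact: integrableS (iq k).
  rewrite EA// -sumEFin; apply: eq_bigr => k _.
  have [_ ik Ek] := Hq k.
  rewrite integralZl//; last exact: integrableS ik.
  by rewrite Ek// EFinM -prE//; exact: measurableI.
Qed.

End conditional_probability.

(** * The law for fixed weights, and the theorem *)

Section mixture_laws.
Context {R : realType} {m n : nat}.
Local Notation plane := (measurableTypeR R * measurableTypeR R)%type.

(** The deterministic core, applied outcome by outcome: it supplies the kernel for the existence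
    claim and the comparison law for the density claim. *)
Lemma mixture_joint_law (B : 'I_m -> 'M[R]_n) (Gam1 Gam2 : {set 'I_(n + 1)})
    (s : 'I_m -> 'I_n -> R) (i : 'I_n) (t : R) :
  (forall k, is_subintensity (B k)) ->
  stochastically_closed (fun k => intensity_of (B k)) Gam1 ->
  stochastically_closed (fun k => intensity_of (B k)) Gam2 ->
  Gam1 :&: Gam2 = [set absorbing n]%SET ->
  (forall k, 0 <= s k i) -> \sum_k s k i = 1 ->
  exists nu : probability plane R,
    has_joint_density t
      (joint_density B (outside_mx R Gam1) (outside_mx R Gam2)
         (fun k => diag_mx (\row_j s k j)) i t) nu /\
    is_survival_measure t
      (fun x y => \sum_k s k i * joint_exit_prob (B k) Gam1 Gam2 i t x y) nu.
Proof.
move=> HB GC1 GC2 G12 s0 s1.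
have a12 : absorbing n \in Gam1 :&: Gam2 by rewrite G12 inE.
have [a1 a2] : absorbing n \in Gam1 /\ absorbing n \in Gam2.
  by move: a12; rewrite inE => /andP[].
have vE (k : 'I_m) : (delta_mx ord0 i : 'rV_n) *m diag_mx (\row_j s k j) =
    s k i *: (delta_mx ord0 i : 'rV[R]_n).
  apply/rowP => j; rewrite mul_mx_diag !mxE eqxx/=.
  by case: eqP => [->|_]; rewrite ?mulr1 ?mul1r// mulr0 mul0r.
have v0 k : mx_ge0 ((delta_mx ord0 i : 'rV_n) *m diag_mx (\row_j s k j)).
  by move=> a b; rewrite vE !mxE mulr_ge0.
have v1 : \sum_k (delta_mx ord0 i : 'rV_n) *m diag_mx (\row_j s k j) = delta_mx ord0 i.
  by rewrite (eq_bigr _ (fun k _ => vE k)) -scaler_suml s1 scale1r.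
have G21 : Gam2 :&: Gam1 = [set absorbing n]%SET by rewrite finset.setIC.
have [nu [fnu nu0 nuQ]] := joint_law_exists t HB
  (is_exit_outside HB GC1) (is_exit_outside HB GC2)
  (outside_mx_disjoint G12) (outside_mx_disjoint G21) v0 v1.
exists nu; split => //; split => [|x y tx ty]; first exact: nu0.
apply: (etrans (nuQ x y tx ty)).
by rewrite survival_exit_prob.
Qed.

End mixture_laws.

Theorem theorem3p10 (d : measure_display) (T : measurableType d) (R : realType)
    (P : probability T R) (m n : nat)
    (B : 'I_m -> 'M[R]_n) (pi0 : 'I_n -> R) (s0 : 'I_m -> 'I_n -> R)
    (phi : T -> 'I_m) (X : R -> T -> 'I_(n + 1))
    (hX : is_mixture_process P B pi0 s0 phi X)
    (Gam1 Gam2 : {set 'I_(n + 1)})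
    (hGam1 : stochastically_closed (fun k => intensity_of (B k)) Gam1)
    (hGam2 : stochastically_closed (fun k => intensity_of (B k)) Gam2)
    (hGam12 : Gam1 :&: Gam2 = [set absorbing n]%SET)
    (hpi : forall i, transient i \notin Gam1 -> transient i \notin Gam2 ->
       pi0 i != 0)
    (htau : P [set w | (0 < hitting_time X Gam1 w)%E /\
                       (0 < hitting_time X Gam2 w)%E] = 1%E)
    (t : R) (ht : 0 <= t)
    (* the information F_(t-) *)
    (G : set (set T)) (hG : sigma_algebra setT G)
    (hGX : G `<=` strict_past X t)
    (* p i is a version of P{X_t = i | F_(t-)} *)
    (p : 'I_n -> T -> R)
    (hp : forall i, is_condprob P G [set w | X t w = transient i] (p i))
    (* s k i is a version of s_i^(k)(t) = P{phi = k | F_(t,i)} *)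
    (s : 'I_m -> 'I_n -> T -> R)
    (hs : forall k i, is_condprob_on P G [set w | X t w = transient i]
       [set w | phi w = k] (s k i))
    (hs1 : forall i w, ~~ (0 < p i w) ->
       (forall k, 0 <= s k i w) /\ \sum_k s k i w = 1)
    (i : 'I_n) :
  let is_version (F : R -> R -> T -> R)
      (nu : T -> probability (measurableTypeR R * measurableTypeR R)%type R) :=
    (forall t1 t2, t <= t1 -> t <= t2 ->
       is_condprob_on P G [set w | X t w = transient i]
         [set w | (t1%:E < hitting_time X Gam1 w)%E /\
                  (t2%:E < hitting_time X Gam2 w)%E] (F t1 t2)) /\
    {ae P, forall w, 0 < p i w ->
       is_survival_measure t (fun t1 t2 => F t1 t2 w) (nu w)} in
  (exists F nu, is_version F nu) /\
  (forall F nu, is_version F nu ->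
     {ae P, forall w, 0 < p i w ->
        has_joint_density t
          (joint_density B (outside_mx R Gam1) (outside_mx R Gam2)
             (fun k => diag_mx (\row_j s k j w)) i t)
          (nu w)}).
Proof.
move=> is_version.
have HB k : is_subintensity (B k).
  by apply: is_subintensity_intensity; [exact: mix_intensity hX k|exact: mix_nonsingular hX k].
have mgen : [set A | exists u x, 0 <= u < t /\ A = [set w | X u w = x]] `<=` measurable.
  by move=> _ [u [x [/andP[u0 _] ->]]]; exact: mix_X_measurable hX _ _ u0.
have mG : G `<=` measurable.
  move=> C /hGX; apply: smallest_sub mgen _; exact: sigma_algebra_measurable.
have mreg k : measurable [set w | phi w = k] by exact: mix_phi_measurable hX k.
have mi : measurable [set w | X t w = transient i] by exact: mix_X_measurable hX _ _ ht.
have mri k : measurable ([set w | phi w = k] `&` [set w | X t w = transient i]).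
  exact: measurableI.
have /choice[pq Hpq] : forall k, exists pq : (T -> R) * (T -> R),
    [/\ is_condprob P G [set w | X t w = transient i] pq.1,
        is_condprob P G ([set w | phi w = k] `&` [set w | X t w = transient i]) pq.2 &
        {ae P, forall w, 0 < pq.1 w -> s k i w = pq.2 w / pq.1 w}].
  by move=> k; have [p' [q' H]] := hs k i; exists (p', q').
pose q k := (pq k).2.
have Hq k : is_condprob P G ([set w | phi w = k] `&` [set w | X t w = transient i]) (q k).
  by have [] := Hpq k.
(* Each [s k i] comes with its own version of the denominator; uniqueness of versions replaces them
   all by [p i]. *)
have sq : {ae P, forall w, forall k, 0 < p i w -> s k i w = q k w / p i w}.
  apply: ae_forall_count => k; have [Hp1 _ Hs1] := Hpq k.
  have := condprob_unique hG mG Hp1 (hp i); apply: filterS2 Hs1 => w Hs1 E.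
  by move: Hs1; rewrite E.
have q0 : {ae P, forall w, forall k, 0 <= q k w}.
  by apply: ae_forall_count => k; exact: (condprob_ge0 mG (Hq k)).
have qp : {ae P, forall w, \sum_k q k w = p i w}.
  have Hsum : is_condprob P G [set w | X t w = transient i]
      (fun w => \sum_k 1 * q k w).
    apply: (condprob_lin hG mG mri Hq) => C GC; have mC := mG _ GC.
    have mCi : measurable (C `&` [set w | X t w = transient i]) by exact: measurableI.
    rewrite setIC prE// (_ : _ `&` _ = (C `&` [set w | X t w = transient i])
      `&` [set w | xpredT (phi w)]); last by apply/seteqP; split => w // [].
    rewrite (pr_partition P xpredT mreg mCi); congr _%:E; apply: eq_bigr => k _.
    by rewrite mul1r setIC setIA setIAC.
  have := condprob_unique hG mG Hsum (hp i); apply: filterS => w <-.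
  by apply: eq_bigr => k _; rewrite mul1r.
(* Being quotients of versions, the weights form a probability vector only almost surely; the
   pointwise arguments below take place on this event. *)
have good : {ae P, forall w, 0 < p i w ->
    [/\ forall k, s k i w = q k w / p i w, forall k, 0 <= s k i w & \sum_k s k i w = 1]}.
  apply: filterS3 sq q0 qp => w sq q0 qp pw.
  have sE k : s k i w = q k w / p i w by exact: sq.
  split => // [k|]; first by rewrite sE divr_ge0// ltW.
  by rewrite (eq_bigr _ (fun k _ => sE k)) -mulr_suml qp divff// gt_eqF.
pose F0 (x y : R) (w : T) := \sum_k s k i w * joint_exit_prob (B k) Gam1 Gam2 i t x y.
pose event (x y : R) := [set w | (x%:E < hitting_time X Gam1 w)%E /\
                                 (y%:E < hitting_time X Gam2 w)%E].
pose qF (x y : R) (w : T) := \sum_k joint_exit_prob (B k) Gam1 Gam2 i t x y * q k w.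
have HqF x y : t <= x -> t <= y ->
    is_condprob P G (event x y `&` [set w | X t w = transient i]) (qF x y).
  move=> tx ty; apply: (condprob_lin hG mG mri Hq) => C GC.
  by apply: (survival_past hX) => //; [exact: hGX|exact: mG].
have F0E : {ae P, forall w, 0 < p i w -> forall x y, F0 x y w = qF x y w / p i w}.
  apply: filterS good => w H pw x y; have [sE _ _] := H pw.
  by rewrite /F0 /qF mulr_suml; apply: eq_bigr => k _; rewrite sE; ring.
split.
(* No measurability in [w] is asked of [nu], so a law can be chosen separately for each outcome,
   with a Dirac mass where the weights are not a probability vector. *)
- have /choice[nu Hnu] : forall w, exists nu : probability
      (measurableTypeR R * measurableTypeR R)%type R,
      (forall k, 0 <= s k i w) -> \sum_k s k i w = 1 ->
      is_survival_measure t (fun x y => F0 x y w) nu.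
    move=> w; have [[s0' s1]|ns] := pselect ((forall k, 0 <= s k i w) /\ \sum_k s k i w = 1).
      have [nu [_ Hnu]] := mixture_joint_law t (s := fun k j => s k j w) HB hGam1 hGam2 hGam12 s0' s1.
      by exists nu.
    by exists (dirac point) => s0' s1; exfalso; apply: ns.
  exists F0, nu; split => [x y tx ty|].
    exists (p i), (qF x y); split; [exact: hp|exact: HqF|].
    by apply: filterS F0E => w H pw; exact: H.
  by apply: filterS good => w H pw; have [_ s0' s1] := H pw; exact: Hnu.
- move=> F nu [HF Hnu].
  (* The exceptional null set of [F] depends on the pair of times, so agreement with [F0] is claimed
     only along the countably many rational offsets that [eq_survival_measure] asks for. *)
  have FF0 : {ae P, forall w, forall r : rat * rat, 0 <= r.1 -> 0 <= r.2 ->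
      0 < p i w -> F (t + ratr r.1) (t + ratr r.2) w = F0 (t + ratr r.1) (t + ratr r.2) w}.
    apply: ae_forall_count => -[a b] /=.
    have [a0|a0] := boolP (0 <= a); last by apply: filterE.
    have [b0|b0] := boolP (0 <= b); last by apply: filterE => w _.
    have ta : t <= t + ratr a by rewrite lerDl ler0q.
    have tb : t <= t + ratr b by rewrite lerDl ler0q.
    have [p' [q' [Hp' Hq' HF']]] := HF _ _ ta tb.
    have Ep := condprob_unique hG mG Hp' (hp i).
    have Eq := condprob_unique hG mG Hq' (HqF _ _ ta tb).
    apply: filterS2 (filterI HF' Ep) (filterI Eq F0E) => w [HFw pw] [qw F0w] _ _ pi_w.
    by rewrite F0w// HFw ?pw// qw.
  apply: filterS3 Hnu good FF0 => w Hnuw goodw FF0w pw.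
  have [_ s0' s1] := goodw pw; have [nu0 nuF] := Hnuw pw.
  have [mu [[mf f0 muE] [mu0 muF]]] :=
    mixture_joint_law t (s := fun k j => s k j w) HB hGam1 hGam2 hGam12 s0' s1.
  have numu : forall A, measurable A -> nu w A = mu A.
    apply: (eq_survival_measure nu0 mu0) => a b a0 b0.
    have ta : t <= t + ratr a by rewrite lerDl ler0q.
    have tb : t <= t + ratr b by rewrite lerDl ler0q.
    apply: (etrans (nuF _ _ ta tb)); apply: esym; apply: (etrans (muF _ _ ta tb)).
    by rewrite (FF0w (a, b)).
  by split => // A mA; apply: (etrans (numu A mA)); exact: muE.
Qed.
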